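(* Let $\{(w^{(k)},b^{(k)},v^{(k)},u^{(k)})\}$ be the (infinite) sequence generated by Algorithm 1 with $\eta_3>1$. Then the following statements hold. (a) $\liminf_{k\to\infty}\|u^{(k)}-\Psi(v^{(k)})w^{(k)}-Ab^{(k)}\|=0$, and the sequence $\{(w^{(k)},b^{(k)},v^{(k)},u^{(k)})\}$ has at least one accumulation point. (b) $\liminf_{k\to\infty}\operatorname{dist}\big((w^{(k)},b^{(k)},v^{(k)},u^{(k)}),\mathcal Z^*\big)=0$, where $\mathcal Z^*$ is the set of KKT points of problem (PP). (c) If in addition $\gamma=1$, then $\lim_{k\to\infty}\|u^{(k)}-\Psi(v^{(k)})w^{(k)}-Ab^{(k)}\|=0$. Furthermore, any accumulation point $(w^*,b^*,v^*,u^* )$ of $\{(w^{(k)},b^{(k)},v^{(k)},u^{(k)})\}$ is a KKT point of problem (PP).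
   Context: Setting. $[K]=\{1,\dots,K\}$; $\|\cdot\|$ is the Euclidean norm. $L,N,N_0,\dots,N_L$ are positive integers, $x_n\in\mathbb R^{N_0}$ and $y_n\in\mathbb R^{N_L}$ ($n\in[N]$) are given data, $Y=(y_1,\dots,y_N)$, and $0<\alpha<1$, $\lambda_w>0$, $\lambda_v>0$, $\beta_\ell>0$ ($\ell\in[L]$) are constants. $\sigma(z)=\max\{z,\alpha z\}$ componentwise. Variables. $W_\ell\in\mathbb R^{N_\ell\times N_{\ell-1}}$, $b_\ell\in\mathbb R^{N_\ell}$, $v_{n,\ell},u_{n,\ell}\in\mathbb R^{N_\ell}$ for $\ell\in[L]$, $n\in[N]$, with $v_{n,0}:=x_n$. Put $\widetilde N=\sum_{\ell=1}^LN_\ell N_{\ell-1}$, $\overline N=\sum_{\ell=1}^LN_\ell$, $m=N\overline N$. The vectors $w\in\mathbb R^{\widetilde N}$ (stacking the column-wise vectorizations of $W_1,\dots,W_L$), $b\in\mathbb R^{\overline N}$ (stacking $b_1,\dots,b_L$), and $v,u\in\mathbb R^m$ (stacking $v_{n,\ell}$, resp. $u_{n,\ell}$, in the order $(1,1),(2,1),\dots,(N,1),(1,2),\dots,(N,L)$ of $(n,\ell)$) collect the variables. The linear-in-$w$ map $\Psi(v)w$ and the matrix $A\in\mathbb R^{m\times\overline N}$ are such that $\Psi(v)w+Ab$ has $(n,\ell)$ block $W_\ell v_{n,\ell-1}+b_\ell$; that is, $\Psi(v)$ is block diagonal with blocks $V_{\ell-1}^\top\otimes I_{N_\ell}$, where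 $V_\ell=(v_{1,\ell},\dots,v_{N,\ell})$, $V_0=(x_1,\dots,x_N)$, and $A$ is block diagonal with blocks $e_N\otimes I_{N_\ell}$ ($e_K$ is the all-ones vector in $\mathbb R^K$). Objective. $\mathcal R_1(w)=\lambda_w\sum_{\ell=1}^L\sum_{j=1}^{N_{\ell-1}}\|(W_\ell)_{\cdot,j}\|$ (with $(W_\ell)_{\cdot,j}$ the $j$-th column), $\mathcal R_2(v)=\lambda_v\|v\|^2$, $\bar{\mathcal O}(w,v)=\frac1N\sum_{n=1}^N\|v_{n,L}-y_n\|^2+\mathcal R_1(w)+\mathcal R_2(v)$. With $\beta=(\beta_1e_{NN_1}^\top,\dots,\beta_Le_{NN_L}^\top)^\top\in\mathbb R^m$, $\mathcal O(w,v,u)=\bar{\mathcal O}(w,v)+\beta^\top(v-\sigma(u))$. Problem (PP): minimize $\mathcal O(w,v,u)$ over $\Omega_2=\{(w,b,v,u): v-u\ge0,\ v-\alpha u\ge 0,\ u=\Psi(v)w+Ab\}$. The number $\theta$ is fixed with $\theta>\frac1N\|Y\|_F^2$, and $\Omega_\theta=\{(w,b,v,u)\in\Omega_2:\mathcal O(w,v,u)\le\theta\}$. KKT points. Let $\mathcal C(v,u)=\binom{u-v}{\alpha u-v}\in\mathbb R^{2m}$. $(w^*,b^*,v^*,u^* )$ is a KKT point of (PP) if there exist $\mu\in\mathbb R^{2m}_+$ and $\xi\in\mathbb R^m$ with $$0\in\partial\mathcal R_1(w^* )-\Psi(v^* )^\top\xi,\qquad 0=A^\top\xi,$$ $$0=\nabla_v\bar{\mathcal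 O}(w^*,v^* )+\beta+\nabla_v\big(\mu^\top\mathcal C(v,u^* )\big)\big|_{v=v^*}-\nabla_v\big(\xi^\top\Psi(v)w^*\big)\big|_{v=v^*},$$ $$0\in\partial_u\big(-\beta^\top\sigma(u)\big)\big|_{u=u^*}+\nabla_u\big(\mu^\top\mathcal C(v^*,u)\big)\big|_{u=u^*}+\xi,$$ $$\mathcal C(v^*,u^* )\le0,\quad\mu^\top\mathcal C(v^*,u^* )=0,\quad u^*-\Psi(v^* )w^*-Ab^*=0,$$ where $\partial$ is the limiting (Mordukhovich) subdifferential. Augmented Lagrangian. For $\rho>0$, $\xi\in\mathbb R^m$, $$\mathcal L_\rho(w,b,v,u;\xi)=\mathcal O(w,v,u)+\langle\xi,u-\Psi(v)w-Ab\rangle+\frac\rho2\|u-\Psi(v)w-Ab\|^2,$$ and $\Omega_3=\{(w,b,v,u): w\in\mathbb R^{\widetilde N},\ b\in\mathbb R^{\overline N},\ \mathcal C(v,u)\le0\}$. Algorithm 1 (run without stopping). Input: $(w^{(0)},b^{(0)},v^{(0)},u^{(0)})\in\Omega_\theta$, $\rho^{(0)}>0$, $\eta_1,\eta_2,\eta_4\in(0,1)$, $\eta_3>0$, $\xi^{(0)}\in\mathbb R^m$, a positive integer $\gamma$, $\epsilon_0>0$. For $k=1,2,\dots$, with $c^{(k)}:=u^{(k)}-\Psi(v^{(k)})w^{(k)}-Ab^{(k)}$: Step 1: find $(w^{(k)},b^{(k)},v^{(k)},u^{(k)})\in\Omega_3$ satisfying both $\mathcal L_{\rho^{(k-1)}}(w^{(k)},b^{(k)},v^{(k)},u^{(k)};\xi^{(k-1)})<\theta$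 and, with index $\epsilon_k$ as in the paper, $$\operatorname{dist}\big(0,\ \partial\mathcal L_{\rho^{(k-1)}}(w^{(k)},b^{(k)},v^{(k)},u^{(k)};\xi^{(k-1)})+\mathcal N_{\Omega_3}(w^{(k)},b^{(k)},v^{(k)},u^{(k)})\big)\le\epsilon_k,$$ where $\partial$ is the limiting subdifferential in $(w,b,v,u)$ and $\mathcal N_{\Omega_3}$ the normal cone. Step 2: $\xi^{(k)}=\xi^{(k-1)}+\rho^{(k-1)}c^{(k)}$. Step 3: if $k\le\gamma$, set $\rho^{(k)}=\rho^{(k-1)}$, $\epsilon_k=\epsilon_{k-1}$. If $k>\gamma$ and $\|c^{(k)}\|\le\eta_1\max_{t=k-\gamma,\dots,k-1}\|c^{(t)}\|$, set $\rho^{(k)}=\rho^{(k-1)}$, $\epsilon_k=\sqrt{\eta_1}\,\epsilon_{k-1}$. Otherwise set $\rho^{(k)}=\max\{\rho^{(k-1)}/\eta_2,\ \|\xi^{(k)}\|^{1+\eta_3}\}$, $\epsilon_k=\eta_4\epsilon_{k-1}$. (The tolerances $\epsilon_k$ appearing in Step 1 are thus those produced by Step 3 of the same iteration.) *)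

(* Defs.v *)
From HB Require Import structures.
From mathcomp Require Import all_boot all_order all_algebra.
From mathcomp Require Import all_classical all_reals all_analysis.
From mathcomp.real_closed Require Import mxtens.

Set Implicit Arguments.
Unset Strict Implicit.
Unset Printing Implicit Defensive.

Import Order.TTheory GRing.Theory Num.Theory.
Import numFieldNormedType.Exports.

Local Open Scope classical_set_scope.
Local Open Scope ring_scope.

Section Euclidean.
Context {R : realType}.

Definition dot n (x y : 'cV[R]_n) : R := \sum_i x i 0 * y i 0.

(* The library norm [`| x |] of a matrix is the sup norm; it induces the same
   topology as [enorm], so convergence and neighbourhoods are the library's. *)
Definition enorm n (x : 'cV[R]_n) : R := Num.sqrt (dot x x).

(* Extended-real valued, so that the distance to the empty set is +oo. *)
Definition dist_to n (x : 'cV[R]_n) (S : set 'cV[R]_n) : \bar R :=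
  ereal_inf [set (enorm (x - y))%:E | y in S].

Definition grad n (f : 'cV[R]_n -> R) (x : 'cV[R]_n) : 'cV[R]_n :=
  \col_i 'D_(delta_mx i 0) (f : 'cV[R]_n -> R^o) x.

Definition frechet_subdiff n (f : 'cV[R]_n -> R) (x : 'cV[R]_n) :
    set 'cV[R]_n :=
  [set g | forall e, 0 < e ->
     \forall y \near x, f x + dot g (y - x) - e * enorm (y - x) <= f y].

Definition limiting_subdiff n (f : 'cV[R]_n -> R) (x : 'cV[R]_n) :
    set 'cV[R]_n :=
  [set g | exists xs gs : nat -> 'cV[R]_n,
     [/\ xs @ \oo --> x,
         (fun k => f (xs k)) @ \oo --> f x,
         forall k, frechet_subdiff f (xs k) (gs k)
       & gs @ \oo --> g]].

Definition frechet_normal n (S : set 'cV[R]_n) (x : 'cV[R]_n) :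
    set 'cV[R]_n :=
  [set g | S x /\ forall e, 0 < e ->
     \forall y \near x, S y -> dot g (y - x) <= e * enorm (y - x)].

Definition limiting_normal n (S : set 'cV[R]_n) (x : 'cV[R]_n) :
    set 'cV[R]_n :=
  [set g | S x /\ exists xs gs : nat -> 'cV[R]_n,
     [/\ xs @ \oo --> x,
         forall k, frechet_normal S (xs k) (gs k)
       & gs @ \oo --> g]].

(* Column-wise vectorization and its inverse: [mxtens_index (j, i)] is the
   index j * p + i, consistently with the Kronecker product [*t]. *)
Definition vec p q (M : 'M[R]_(p, q)) : 'cV[R]_(q * p) :=
  \col_k M (mxtens_unindex k).2 (mxtens_unindex k).1.
Definition unvec p q (x : 'cV[R]_(q * p)) : 'M[R]_(p, q) :=
  \matrix_(i, j) x (mxtens_index (j, i)) 0.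

End Euclidean.

(* The network has [L.+1] layers (so its depth is positive), of widths
   [d 0], ..., [d L.+1], and there are [N] samples; the index [l : 'I_L.+1]
   stands for the layer l + 1, which maps dimension [d l] to [d l.+1]. *)
Notation dim_w L d := (\sum_(l < L.+1) d l * d l.+1)%N.
Notation dim_b L d := (\sum_(l < L.+1) d l.+1)%N.
Notation dim_v L N d := (\sum_(l < L.+1) N * d l.+1)%N.
Notation dim_z L N d := ((dim_w L d + dim_b L d) + (dim_v L N d + dim_v L N d))%N.

Section Network.
Context {R : realType} {L N : nat} {d : nat -> nat}.
Local Notation cvW := 'cV[R]_(dim_w L d).
Local Notation cvB := 'cV[R]_(dim_b L d).
Local Notation cvV := 'cV[R]_(dim_v L N d).
Local Notation cvZ := 'cV[R]_(dim_z L N d).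

Definition weight (w : cvW) (l : 'I_L.+1) : 'M[R]_(d l.+1, d l) :=
  unvec (submxcol w l).

(* The matrix V_(l+1) whose n-th column is v_(n,l+1). *)
Definition layer (v : cvV) (l : 'I_L.+1) : 'M[R]_(d l.+1, N) :=
  unvec (submxcol v l).

(* The matrix V_l of the inputs of the layer l + 1, with V_0 = X. *)
Definition layer_input (X : 'M[R]_(d 0%N, N)) (v : cvV) (l : 'I_L.+1) :
    'M[R]_(d l, N) :=
  let: Ordinal k hk := l in
  match k return (k < L.+1)%N -> 'M[R]_(d k, N) with
  | 0 => fun=> X
  | j.+1 => fun h => layer v (Ordinal (ltnW h))
  end hk.

(* In the block (l, l') of the two matrices below, the rectangular matrix
   [pid_mx] makes the expression well typed; for l = l' it is the identity. *)
Definition Psi (X : 'M[R]_(d 0%N, N)) (v : cvV) :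
    'M[R]_(dim_v L N d, dim_w L d) :=
  \mxblock_(l < L.+1, l' < L.+1)
    (if l == l' then
       (layer_input X v l')^T *t (pid_mx (d l.+1) : 'M[R]_(d l.+1, d l'.+1))
     else 0).

Definition Amx : 'M[R]_(dim_v L N d, dim_b L d) :=
  \mxblock_(l < L.+1, l' < L.+1)
    (if l == l' then
       castmx (erefl _, mul1n _)
         ((const_mx 1 : 'cV[R]_N) *t (pid_mx (d l.+1) : 'M[R]_(d l.+1, d l'.+1)))
     else 0).

Lemma Amx_entry p (n : 'I_N) (r j : 'I_p) :
  castmx (erefl (N * p)%N, mul1n p)
    ((const_mx 1 : 'cV[R]_N) *t (1%:M : 'M[R]_p)) (mxtens_index (n, r)) j
  = (r == j)%:R.
Proof.
rewrite castmxE cast_ord_id mxE mxtens_indexK mxE mul1r mxE.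
congr (nat_of_bool _)%:R; rewrite [X in _ == X](_ : _ = j) //.
apply: val_inj; rewrite [LHS]/=; rewrite modn_small //.
Qed.

(* The (n, l + 1) block of Psi(v) w + A b is W_(l+1) v_(n,l) + b_(l+1). *)
Lemma Psi_Amx_block (X : 'M[R]_(d 0%N, N)) (w : cvW) (b : cvB) (v : cvV)
    (l : 'I_L.+1) :
  submxcol (Psi X v *m w + Amx *m b) l
  = vec (weight w l *m layer_input X v l + submxcol b l *m const_mx 1).
Proof.
rewrite submxcolD -!submxcol_mul /Psi /Amx !submxcol_matrix.
rewrite -[w in LHS]submxcolK -[b in LHS]submxcolK !mul_mxrow_mxcol.
transitivity (((layer_input X v l)^T *t 1%:M) *m submxcol w l
  + castmx (erefl _, mul1n _) ((const_mx 1 : 'cV[R]_N) *t 1%:M) *m submxcol b l).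
  congr (_ + _).
    rewrite (bigD1 l) // big1 ?Monoid.mulm1 => [|i /andP[_ /negbTE il]].
      by rewrite eqxx pid_mx_1.
    by rewrite [l == i]eq_sym il mul0mx.
  rewrite (bigD1 l) // big1 ?Monoid.mulm1 => [|i /andP[_ /negbTE il]].
    by rewrite eqxx pid_mx_1.
  by rewrite [l == i]eq_sym il mul0mx.
apply/colP => k; case: (mxtens_indexP k) => n r.
rewrite !mxE !mxtens_indexK /=; congr (_ + _).
  rewrite (reindex (@mxtens_index _ _)) /=; last first.
    exists (@mxtens_unindex _ _) => ? _;
      by rewrite (mxtens_indexK, mxtens_unindexK).
  transitivity (\sum_(i < d l) \sum_(j < d l.+1)
      (layer_input X v l i n * (r == j)%:R
       * submxcol w l (mxtens_index (i, j)) 0)).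
    by rewrite pair_bigA; apply: eq_bigr => -[i j] _; rewrite !mxE ?mxtens_indexK.
  apply: eq_bigr => i _.
  rewrite (bigD1 r) // big1 ?Monoid.mulm1 => [|j /andP[_ /negbTE jr]].
    by rewrite /= eqxx mulr1 mulrC !mxE.
  by rewrite [r == j]eq_sym jr mulr0 mul0r.
rewrite big_ord1 [const_mx 1 _ _]mxE mulr1.
rewrite (bigD1 r) // big1 ?Monoid.mulm1 => [|j /andP[_ /negbTE jr]].
  by rewrite /= Amx_entry eqxx mul1r ?mxE.
by rewrite Amx_entry [r == j]eq_sym jr mul0r.
Qed.

Definition sigma (alpha : R) n (x : 'cV[R]_n) : 'cV[R]_n :=
  map_mx (fun t => Num.max t (alpha * t)) x.

Definition frob2 p q (M : 'M[R]_(p, q)) : R := \sum_i \sum_j M i j ^+ 2.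

Definition reg1 (lw : R) (w : cvW) : R :=
  lw * \sum_(l < L.+1) \sum_(j < d l) enorm (col j (weight w l)).

Definition reg2 (lv : R) (v : cvV) : R := lv * enorm v ^+ 2.

Definition obj_bar (Y : 'M[R]_(d L.+1, N)) (lw lv : R) (w : cvW) (v : cvV) : R :=
  N%:R^-1 * \sum_(n < N) enorm (col n (layer v ord_max) - col n Y) ^+ 2
  + reg1 lw w + reg2 lv v.

Definition beta_vec (beta : 'I_L.+1 -> R) : cvV :=
  \mxcol_(l < L.+1) const_mx (beta l).

Definition obj (Y : 'M[R]_(d L.+1, N)) (alpha lw lv : R) (beta : 'I_L.+1 -> R)
    (w : cvW) (v u : cvV) : R :=
  obj_bar Y lw lv w v + dot (beta_vec beta) (v - sigma alpha u).

Definition residual (X : 'M[R]_(d 0%N, N)) (w : cvW) (b : cvB) (v u : cvV) : cvV :=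
  u - Psi X v *m w - Amx *m b.

Definition Omega2 (X : 'M[R]_(d 0%N, N)) (alpha : R)
    (w : cvW) (b : cvB) (v u : cvV) : Prop :=
  [/\ forall i, 0 <= (v - u) i 0,
      forall i, 0 <= (v - alpha *: u) i 0
    & u = Psi X v *m w + Amx *m b].

Definition Omega_theta (X : 'M[R]_(d 0%N, N)) (Y : 'M[R]_(d L.+1, N))
    (alpha lw lv : R) (beta : 'I_L.+1 -> R) (theta : R)
    (w : cvW) (b : cvB) (v u : cvV) : Prop :=
  Omega2 X alpha w b v u /\ obj Y alpha lw lv beta w v u <= theta.

Definition cstr (alpha : R) (v u : cvV) : 'cV[R]_(dim_v L N d + dim_v L N d) :=
  col_mx (u - v) (alpha *: u - v).

Definition Omega3 (alpha : R) (w : cvW) (b : cvB) (v u : cvV) : Prop :=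
  forall i, cstr alpha v u i 0 <= 0.

Definition KKT_point (X : 'M[R]_(d 0%N, N)) (Y : 'M[R]_(d L.+1, N))
    (alpha lw lv : R) (beta : 'I_L.+1 -> R)
    (w : cvW) (b : cvB) (v u : cvV) : Prop :=
  exists (mu : 'cV[R]_(dim_v L N d + dim_v L N d)) (xi : cvV),
  [/\ (forall i, 0 <= mu i 0),
      [set g - (Psi X v)^T *m xi | g in limiting_subdiff (reg1 lw) w] 0
        /\ 0 = Amx^T *m xi,
      0 = grad (obj_bar Y lw lv w) v + beta_vec beta
          + grad (fun v' => dot mu (cstr alpha v' u)) v
          - grad (fun v' => dot xi (Psi X v' *m w)) v,
      [set g + grad (fun u' => dot mu (cstr alpha v u')) u + xi
        | g in limiting_subdiff
                 (fun u' => - dot (beta_vec beta) (sigma alpha u')) u] 0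
    & [/\ forall i, cstr alpha v u i 0 <= 0,
          dot mu (cstr alpha v u) = 0
        & u - Psi X v *m w - Amx *m b = 0]].

Definition aug_lag (X : 'M[R]_(d 0%N, N)) (Y : 'M[R]_(d L.+1, N))
    (alpha lw lv : R) (beta : 'I_L.+1 -> R) (rho : R) (xi : cvV)
    (w : cvW) (b : cvB) (v u : cvV) : R :=
  obj Y alpha lw lv beta w v u + dot xi (residual X w b v u)
  + rho / 2 * enorm (residual X w b v u) ^+ 2.

Definition stack (w : cvW) (b : cvB) (v u : cvV) : cvZ :=
  col_mx (col_mx w b) (col_mx v u).

Definition on_stack T (f : cvW -> cvB -> cvV -> cvV -> T) (z : cvZ) : T :=
  f (usubmx (usubmx z)) (dsubmx (usubmx z))
    (usubmx (dsubmx z)) (dsubmx (dsubmx z)).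

(* Fields are stated for the iteration k + 1, k >= 0. The default value 0 of the
   maximum is harmless: norms are nonnegative and its range is nonempty. The
   tolerance [eps k.+1] in [alg_stationary] is the one set by [alg_update]. *)
Record algorithm1 (X : 'M[R]_(d 0%N, N)) (Y : 'M[R]_(d L.+1, N))
    (alpha lw lv : R) (beta : 'I_L.+1 -> R) (theta eta1 eta2 eta3 eta4 : R)
    (gamma : nat) (w : nat -> cvW) (b : nat -> cvB) (v u xi : nat -> cvV)
    (rho eps : nat -> R) : Prop := Algorithm1 {
  alg_feasible : forall k, Omega3 alpha (w k.+1) (b k.+1) (v k.+1) (u k.+1);
  alg_descent : forall k,
    aug_lag X Y alpha lw lv beta (rho k) (xi k)
      (w k.+1) (b k.+1) (v k.+1) (u k.+1) < theta;
  alg_stationary : forall k,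
    let z := stack (w k.+1) (b k.+1) (v k.+1) (u k.+1) in
    (dist_to 0
       ([set g + h
          | g in limiting_subdiff
                   (on_stack (aug_lag X Y alpha lw lv beta (rho k) (xi k))) z
          & h in limiting_normal (on_stack (Omega3 alpha)) z])%R
     <= (eps k.+1)%:E)%E;
  alg_multiplier : forall k,
    xi k.+1 = xi k
      + rho k *: residual X (w k.+1) (b k.+1) (v k.+1) (u k.+1);
  alg_update : forall k,
    let c t := enorm (residual X (w t) (b t) (v t) (u t)) in
    (rho k.+1, eps k.+1) =
      if (k.+1 <= gamma)%N then (rho k, eps k)
      else if c k.+1 <= eta1 * \big[Num.max/0]_(k.+1 - gamma <= t < k.+1) c t
      then (rho k, Num.sqrt eta1 * eps k)
      else (Num.max (rho k / eta2) (enorm (xi k.+1) `^ (1 + eta3)),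
            eta4 * eps k)
}.

End Network.

Arguments Amx {R L N d}.
Arguments stack {R L N} d w b v u.
Arguments on_stack {R L N} d {T} f z.

(* Main.v *)
Require Import Defs.
From HB Require Import structures.
From mathcomp Require Import all_boot all_order all_algebra.
From mathcomp Require Import all_classical all_reals all_analysis.
From mathcomp Require Import ring lra.
From mathcomp.real_closed Require Import mxtens.

Set Implicit Arguments.
Unset Strict Implicit.
Unset Printing Implicit Defensive.

Import Order.TTheory GRing.Theory Num.Theory.
Import numFieldNormedType.Exports.

Local Open Scope classical_set_scope.
Local Open Scope ring_scope.


(** Two things have to be shown: the residual of the coupling constraint vanishes
    along the iterates (along a subsequence, or everywhere for [gamma = 1]), and
    every limit of almost stationary points with vanishing residual is a KKT
    point.

    Limits of almost stationary points. The augmented Lagrangian is a sum of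
    [reg1] in [w], of [- dot (beta_vec beta) (sigma alpha u)] in [u], and of terms
    that are quadratic in each block of variables, so its Frechet subgradients
    are computed block by block (lemmas [lagrangian_subdiff_w] to
    [lagrangian_subdiff_u]); they have the form of the KKT system with the
    multiplier [xi + rho *: residual]. What remains is to bound these multipliers,
    without any constraint qualification. The normals to the feasible set are
    described coordinatewise by [Omega3_normal_vu]; they satisfy
    [`|hu| <= `|hv|]. The equation in [v] at a layer involves only the multipliers
    of the next layer ([Psi_deriv_next]), hence bounds [hv] at that layer by
    them; then [hu], and through the equation in [u] the multiplier of the layer
    itself, are bounded. Starting from the last layer, where there is no next
    one, backward induction bounds all multipliers as soon as the points
    themselves converge. A convergent subsequence of multipliers and normals
    gives the KKT system in the limit ([stationary_limit_KKT],
    [almost_stationary_limit_KKT]).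

    Residuals. As the objective is nonnegative on the feasible set, the descent
    condition bounds the next objective value by [theta + enorm xi ^+ 2 / rho] and
    the square of the next residual by
    [4 * theta / rho + 4 * (enorm xi / rho) ^+ 2] ([aug_lag_bounds]). If the
    penalty is increased infinitely often, then [rho] tends to infinity while
    [enorm xi ^+ 2 <= K * rho] right after each increase, so that the residuals
    which follow the increases tend to 0 and the objective is bounded there. If
    not, the residuals decay geometrically, the multipliers move by summable
    steps and are bounded, and [rho] is eventually constant. In both cases
    [good_iterations] provides arbitrarily late iterations with a small residual
    and a bounded objective. The objective is coercive in [w], [v] and [u]
    ([obj_coercive]), and [b] is determined by the other blocks and the residual,
    so these iterations accumulate somewhere ([bounded_obj_subcvg]). For
    [gamma = 1], between two increases a combination of [enorm xi / rho] and
    of the residual does not grow ([residual_cvg0_many]), so that the whole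
    sequence of residuals tends to 0 and every accumulation point is the limit of
    a subsequence to which the first part applies. *)

(** * Euclidean geometry *)

Section EuclideanTheory.
Context {R : realType}.
Implicit Types (n : nat).

Lemma coordD n (x y : 'cV[R]_n) i : (x + y) i 0 = x i 0 + y i 0.
Proof. by rewrite mxE. Qed.

Lemma coordB n (x y : 'cV[R]_n) i : (x - y) i 0 = x i 0 - y i 0.
Proof. by rewrite !mxE. Qed.

Lemma coordN n (x : 'cV[R]_n) i : (- x) i 0 = - x i 0.
Proof. by rewrite mxE. Qed.

Lemma coordZ n a (x : 'cV[R]_n) i : (a *: x) i 0 = a * x i 0.
Proof. by rewrite mxE. Qed.

Lemma dotC n (x y : 'cV[R]_n) : dot x y = dot y x.
Proof. by apply: eq_bigr => i _; rewrite mulrC. Qed.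

Lemma dotDl n (x y z : 'cV[R]_n) : dot (x + y) z = dot x z + dot y z.
Proof. by rewrite -big_split; apply: eq_bigr => i _; rewrite mxE mulrDl. Qed.

Lemma dotZl n a (x z : 'cV[R]_n) : dot (a *: x) z = a * dot x z.
Proof. by rewrite mulr_sumr; apply: eq_bigr => i _; rewrite mxE mulrA. Qed.

Lemma dotNl n (x z : 'cV[R]_n) : dot (- x) z = - dot x z.
Proof. by rewrite -scaleN1r dotZl mulN1r. Qed.

Lemma dotBl n (x y z : 'cV[R]_n) : dot (x - y) z = dot x z - dot y z.
Proof. by rewrite dotDl dotNl. Qed.

Lemma dotDr n (x y z : 'cV[R]_n) : dot z (x + y) = dot z x + dot z y.
Proof. by rewrite dotC dotDl !(dotC z). Qed.

Lemma dotNr n (x z : 'cV[R]_n) : dot z (- x) = - dot z x.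
Proof. by rewrite dotC dotNl dotC. Qed.

Lemma dotBr n (x y z : 'cV[R]_n) : dot z (x - y) = dot z x - dot z y.
Proof. by rewrite dotDr dotNr. Qed.

Lemma dotZr n a (x z : 'cV[R]_n) : dot z (a *: x) = a * dot z x.
Proof. by rewrite dotC dotZl dotC. Qed.

Lemma dot0l n (x : 'cV[R]_n) : dot 0 x = 0.
Proof. by rewrite -(scale0r 0) dotZl mul0r. Qed.

Lemma dot0r n (x : 'cV[R]_n) : dot x 0 = 0.
Proof. by rewrite dotC dot0l. Qed.

Lemma dot_delta n (x : 'cV[R]_n) i : dot x (delta_mx i 0) = x i 0.
Proof.
rewrite /dot (bigD1 i) //= big1 ?addr0 => [|j /negbTE ji].
  by rewrite mxE !eqxx mulr1.
by rewrite mxE ji mulr0.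
Qed.

Lemma dot_mulmx n m (M : 'M[R]_(m, n)) (x : 'cV[R]_m) (y : 'cV[R]_n) :
  dot x (M *m y) = dot (M^T *m x) y.
Proof.
transitivity (\sum_i \sum_j x i 0 * (M i j * y j 0)).
  by apply: eq_bigr => i _; rewrite mxE mulr_sumr.
rewrite exchange_big; apply: eq_bigr => j _ /=.
rewrite mxE mulr_suml; apply: eq_bigr => i _.
by rewrite mxE mulrA [x i 0 * _]mulrC.
Qed.

Lemma dot_col_mx m n (x : 'cV[R]_m) (y : 'cV[R]_n) x' y' :
  dot (col_mx x y) (col_mx x' y') = dot x x' + dot y y'.
Proof.
rewrite /dot big_split_ord /=; congr (_ + _); apply: eq_bigr => i _;
  by rewrite ?col_mxEu ?col_mxEd.
Qed.

Lemma dot_ge0 n (x : 'cV[R]_n) : 0 <= dot x x.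
Proof. by apply: sumr_ge0 => i _; rewrite -expr2 sqr_ge0. Qed.

Lemma enorm_ge0 n (x : 'cV[R]_n) : 0 <= enorm x.
Proof. exact: sqrtr_ge0. Qed.

Lemma sqr_enorm n (x : 'cV[R]_n) : enorm x ^+ 2 = dot x x.
Proof. by rewrite sqr_sqrtr // dot_ge0. Qed.

Lemma enormN n (x : 'cV[R]_n) : enorm (- x) = enorm x.
Proof. by rewrite /enorm dotNl dotNr opprK. Qed.

Lemma enormZ n a (x : 'cV[R]_n) : enorm (a *: x) = `|a| * enorm x.
Proof.
by rewrite /enorm dotZl dotZr mulrA -expr2 sqrtrM ?sqr_ge0 // sqrtr_sqr.
Qed.

Lemma dot_eq0 n (x : 'cV[R]_n) : dot x x = 0 -> x = 0.
Proof.
move/eqP; rewrite psumr_eq0 => [/allP x0|i _]; last by rewrite -expr2 sqr_ge0.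
apply/colP => i; have := x0 i; rewrite mem_index_enum => /(_ isT) /=.
by rewrite mulf_eq0 orbb => /eqP ->; rewrite mxE.
Qed.

Lemma cauchy_schwarz n (x y : 'cV[R]_n) : `|dot x y| <= enorm x * enorm y.
Proof.
rewrite -ler_sqr ?nnegrE ?mulr_ge0 ?enorm_ge0 // exprMn !sqr_enorm.
rewrite real_normK ?num_real //.
have [/dot_eq0 ->|y0] := eqVneq (dot y y) 0.
  by rewrite !dot0r mulr0 expr0n.
have yp : 0 < dot y y by rewrite lt_neqAle eq_sym y0 dot_ge0.
rewrite -(ler_pM2r yp) -subr_ge0.
(* up to the factor |y|^2, this is the part of x that is orthogonal to y *)
have := dot_ge0 (dot y y *: x - dot x y *: y).
rewrite dotBl !dotBr !dotZl !dotZr [dot y x]dotC.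
move: (dot x x) (dot x y) (dot y y) => a b c; congr (0 <= _); ring.
Qed.

Lemma ler_enormD n (x y : 'cV[R]_n) : enorm (x + y) <= enorm x + enorm y.
Proof.
rewrite -ler_sqr ?nnegrE ?addr_ge0 ?enorm_ge0 // sqr_enorm dotDl !dotDr.
rewrite sqrrD !sqr_enorm [dot y x]dotC.
have := le_trans (ler_norm _) (cauchy_schwarz x y).
by rewrite mulr2n; lra.
Qed.

Lemma coord_le_enorm n (x : 'cV[R]_n) i : `|x i 0| <= enorm x.
Proof.
rewrite -ler_sqr ?nnegrE ?enorm_ge0 // real_normK ?num_real //.
rewrite sqr_enorm /dot (bigD1 i) //= expr2 lerDl.
by apply: sumr_ge0 => j _; rewrite -expr2 sqr_ge0.
Qed.

Lemma enorm_le_sum n (x : 'cV[R]_n) : enorm x <= \sum_i `|x i 0|.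
Proof.
rewrite -ler_sqr ?nnegrE ?enorm_ge0 ?sumr_ge0 // sqr_enorm expr2 mulr_sumr.
apply: ler_sum => i _; rewrite -expr2 -real_normK ?num_real // expr2 mulrC.
by rewrite ler_wpM2r // (bigD1 i) //= lerDl sumr_ge0.
Qed.

Lemma enorm_mulmx_le m n (M : 'M[R]_(m, n)) :
  exists2 C, 0 <= C & forall x, enorm (M *m x) ^+ 2 <= C * enorm x ^+ 2.
Proof.
pose K := \sum_i \sum_j `|M i j|.
exists (K ^+ 2) => [|x]; first by rewrite sqr_ge0.
have K0 : 0 <= K by rewrite !sumr_ge0 // => i _; rewrite sumr_ge0.
rewrite -exprMn ler_sqr ?nnegrE ?mulr_ge0 ?enorm_ge0 //.
apply: (le_trans (enorm_le_sum _)); rewrite mulr_suml; apply: ler_sum => i _.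
rewrite mxE mulr_suml; apply: (le_trans (ler_norm_sum _ _ _)).
by apply: ler_sum => j _; rewrite normrM ler_wpM2l // coord_le_enorm.
Qed.

(** ** Neighbourhoods and limits *)

(** The sup norm of the matrix topology and the Euclidean norm differ by a factor
    at most [n], so either gives the neighbourhoods. *)
Lemma near_enormP n (x : 'cV[R]_n) (P : set 'cV[R]_n) :
  (\forall y \near x, P y) <->
  exists2 e, 0 < e & forall y, enorm (y - x) < e -> P y.
Proof.
have le_norm (y : 'cV[R]_n) : `|y| <= enorm y.
  rewrite [leLHS]/Num.Def.normr /= mx_normrE.
  apply: bigmax_le => [|[i j] _ /=]; first exact: enorm_ge0.
  by rewrite [j]ord1 coord_le_enorm.
have coord_le (y : 'cV[R]_n) i : `|y i 0| <= `|y|.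
  rewrite [leRHS]/Num.Def.normr /= mx_normrE.
  by apply/bigmax_geP; right; exists (i, 0).
split=> [/nbhs_normP[e /= e0 eP]|[e e0 eP]].
  exists e => // y yx; apply: eP => /=; rewrite distrC.
  exact: le_lt_trans (le_norm _) yx.
apply/nbhs_normP; exists (e / n.+1%:R) => [|y /=]; first exact: divr_gt0.
rewrite distrC => yx; apply: eP; apply: (le_lt_trans (enorm_le_sum _)).
apply: (@le_lt_trans _ _ (\sum_(i < n) e / n.+1%:R)).
  by apply: ler_sum => i _; exact: le_trans (coord_le _ _) (ltW yx).
rewrite sumr_const card_ord -[_ *+ n]mulr_natr -mulrA gtr_pMr //.
by rewrite mulrC ltr_pdivrMr // mul1r ltr_nat.
Qed.

Lemma cvg_enormP n (xs : nat -> 'cV[R]_n) (x : 'cV[R]_n) :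
  xs @ \oo --> x <-> (fun k => enorm (xs k - x)) @ \oo --> (0 : R).
Proof.
split=> [xx|/cvgrPdist_lt xx].
  apply/cvgrPdist_lt => e e0.
  have : \forall k \near \oo, enorm (xs k - x) < e.
    apply: (xx [set y | enorm (y - x) < e]).
    by apply/near_enormP; exists e.
  apply: filterS => k.
  by rewrite /= sub0r normrN ger0_norm ?enorm_ge0.
move=> P /near_enormP [e e0 eP]; apply: (filterS _ (xx _ e0)) => k.
by rewrite sub0r normrN ger0_norm ?enorm_ge0 // => /eP.
Qed.

Lemma cvg_enorm_lt n (xs : nat -> 'cV[R]_n) (x : 'cV[R]_n) e :
  xs @ \oo --> x -> 0 < e -> \forall k \near \oo, enorm (xs k - x) < e.
Proof.
move=> /cvg_enormP/cvgrPdist_lt xx /xx; apply: filterS => k.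
by rewrite sub0r normrN ger0_norm ?enorm_ge0.
Qed.

Lemma limit_le (s t : nat -> R) (a b : R) :
  s @ \oo --> a -> t @ \oo --> b -> (forall k, s k <= t k) -> a <= b.
Proof. by move=> sa tb st; apply: (ler_cvg_to sa tb); exact: nearW. Qed.

Lemma limit_eq (s t : nat -> R) (a b : R) :
  s @ \oo --> a -> t @ \oo --> b -> (forall k, s k = t k) -> a = b.
Proof.
move=> sa tb st; apply/eqP; rewrite eq_le.
by rewrite (limit_le sa tb) ?(limit_le tb sa) // => k; rewrite st.
Qed.

Lemma cvg_sumr n (s : 'I_n -> nat -> R) (l : 'I_n -> R) :
  (forall i, s i @ \oo --> l i) ->
  (fun k => \sum_i s i k) @ \oo --> \sum_i l i.
Proof.
move=> sl; rewrite (_ : (fun k => _) = \sum_i s i); last first.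
  by apply/funext => k; rewrite fct_sumE.
apply: (big_ind2 (fun (f : nat -> R) a => f @ \oo --> a)) => [|f a g b fa gb|i _].
- exact: cvg_cst.
- exact: cvgD.
- exact: sl.
Qed.

Lemma cvg_coordP n (xs : nat -> 'cV[R]_n) (x : 'cV[R]_n) :
  xs @ \oo --> x <-> forall i, (fun k => xs k i 0) @ \oo --> x i 0.
Proof.
split=> [/cvg_enormP/cvgrPdist_lt xx i|xx].
  apply/cvgrPdist_lt => e e0; apply: filterS (xx _ e0) => k.
  rewrite sub0r normrN ger0_norm ?enorm_ge0 // distrC; apply: le_lt_trans.
  have -> : xs k i 0 - x i 0 = (xs k - x) i 0 by rewrite !mxE.
  exact: coord_le_enorm.
apply/cvg_enormP.
apply: (@squeeze_cvgr _ _ _ _ (fun=> 0)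
  (fun k => \sum_i `|xs k i 0 - x i 0|)).
- apply: nearW => k; rewrite enorm_ge0 /=; apply: (le_trans (enorm_le_sum _)).
  by apply: ler_sum => i _; rewrite !mxE.
- exact: cvg_cst.
have := @cvg_sumr n (fun i k => `|xs k i 0 - x i 0|) (fun=> 0).
rewrite big1 //; apply=> i.
rewrite -[X in _ --> X](@normr0 _ R); apply: cvg_norm.
rewrite -(subrr (x i 0)); apply: cvgB => //; exact: cvg_cst.
Qed.

Lemma cvg_near n (xs ys : nat -> 'cV[R]_n) (x : 'cV[R]_n) (s : nat -> R) :
  xs @ \oo --> x -> s @ \oo --> (0 : R) ->
  (forall k, enorm (ys k - xs k) <= s k) -> ys @ \oo --> x.
Proof.
move=> /cvg_enormP xx s0 yx; apply/cvg_enormP.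
apply: (@squeeze_cvgr _ _ _ _ (fun=> 0) (fun k => s k + enorm (xs k - x))).
- apply: nearW => k; rewrite enorm_ge0 /=.
  have -> : ys k - x = (ys k - xs k) + (xs k - x) by rewrite addrA subrK.
  by apply: (le_trans (ler_enormD _ _)); rewrite lerD2r.
- exact: cvg_cst.
- by rewrite -[X in _ --> X]addr0; exact: cvgD.
Qed.

Lemma cvg_dot n (xs ys : nat -> 'cV[R]_n) x y :
  xs @ \oo --> x -> ys @ \oo --> y ->
  (fun k => dot (xs k) (ys k)) @ \oo --> dot x y.
Proof.
move=> /cvg_coordP xx /cvg_coordP yy.
by apply: (@cvg_sumr n (fun i k => xs k i 0 * ys k i 0)) => i; exact: cvgM.
Qed.

Lemma cvg_enorm n (xs : nat -> 'cV[R]_n) x :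
  xs @ \oo --> x -> (fun k => enorm (xs k)) @ \oo --> enorm x.
Proof.
move=> xx; have /cvg_comp := cvg_dot xx xx; apply; exact: sqrt_continuous.
Qed.

Lemma cvg_mulmx m n (Ms : nat -> 'M[R]_(m, n)) (M : 'M[R]_(m, n))
    (xs : nat -> 'cV[R]_n) (x : 'cV[R]_n) :
  (forall i j, (fun k => Ms k i j) @ \oo --> M i j) -> xs @ \oo --> x ->
  (fun k => Ms k *m xs k) @ \oo --> M *m x.
Proof.
move=> MM /cvg_coordP xx; apply/cvg_coordP => i; rewrite mxE.
rewrite (_ : (fun k => _) = fun k => \sum_j Ms k i j * xs k j 0); last first.
  by apply/funext => k; rewrite mxE.
apply: (@cvg_sumr n (fun j k => Ms k i j * xs k j 0)) => j.
exact: cvgM.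
Qed.

Lemma cvg_col_mx m n (xs : nat -> 'cV[R]_m) (x : 'cV[R]_m)
    (ys : nat -> 'cV[R]_n) (y : 'cV[R]_n) :
  (fun k => col_mx (xs k) (ys k)) @ \oo --> col_mx x y <->
  xs @ \oo --> x /\ ys @ \oo --> y.
Proof.
split=> [/cvg_coordP xy|[/cvg_coordP xx /cvg_coordP yy]].
  split; apply/cvg_coordP => i.
    by have := xy (lshift _ i); under eq_cvg do rewrite col_mxEu; rewrite col_mxEu.
  by have := xy (rshift _ i); under eq_cvg do rewrite col_mxEd; rewrite col_mxEd.
apply/cvg_coordP => i; case: (split_ordP i) => j ->.
  by under eq_cvg do rewrite col_mxEu; rewrite col_mxEu; exact: xx.
by under eq_cvg do rewrite col_mxEd; rewrite col_mxEd; exact: yy.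
Qed.

(** ** Bounded sequences and subsequences *)

Definition bounded_seq (s : nat -> R) := exists C, forall k, `|s k| <= C.

Lemma cvg_bounded_seq (s : nat -> R) (l : R) : s @ \oo --> l -> bounded_seq s.
Proof.
move=> sl; have /cvg_seq_bounded [C [_ /(_ (C + 1))]] : cvgn s.
  by apply/cvg_ex; exists l.
by rewrite ltrDl => /(_ ltr01) H; exists (C + 1) => k; exact: H.
Qed.

Lemma bounded_seqD (s t : nat -> R) :
  bounded_seq s -> bounded_seq t -> bounded_seq (fun k => s k + t k).
Proof.
move=> [C Cs] [D Dt]; exists (C + D) => k.
by rewrite (le_trans (ler_normD _ _)) // lerD.
Qed.

Lemma bounded_seqM (s t : nat -> R) :
  bounded_seq s -> bounded_seq t -> bounded_seq (fun k => s k * t k).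
Proof.
by move=> [C Cs] [D Dt]; exists (C * D) => k; rewrite normrM ler_pM.
Qed.

Lemma bounded_seq_le (s t : nat -> R) :
  (forall k, `|s k| <= t k) -> bounded_seq t -> bounded_seq s.
Proof.
move=> st [C Ct]; exists C => k.
by rewrite (le_trans (st k)) // (le_trans (ler_norm _)).
Qed.

Lemma bounded_seqN (s : nat -> R) :
  bounded_seq s -> bounded_seq (fun k => - s k).
Proof. by move=> [C Cs]; exists C => k; rewrite normrN. Qed.

Lemma bounded_seq_norm (s : nat -> R) :
  bounded_seq s -> bounded_seq (fun k => `|s k|).
Proof. by move=> [C Cs]; exists C => k; rewrite normr_id. Qed.

Lemma bounded_seq_cst c : bounded_seq (fun=> c).
Proof. by exists `|c|. Qed.

Lemma bounded_seq_sum n (s : 'I_n -> nat -> R) :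
  (forall i, bounded_seq (s i)) -> bounded_seq (fun k => \sum_i s i k).
Proof.
move=> sb; rewrite (_ : (fun k => _) = \sum_i s i); last first.
  by apply/funext => k; rewrite fct_sumE.
elim/big_ind : _ => [|f g fb gb|i _]; last exact: sb.
- exact: (bounded_seq_cst 0).
- exact: bounded_seqD.
Qed.

Lemma increasing_seq_cvg (phi : nat -> nat) :
  increasing_seq phi -> phi @ \oo --> \oo.
Proof.
move=> incr.
have phi_ge k : (k <= phi k)%N.
  elim: k => // k IHk; apply: (leq_ltn_trans IHk).
  by move/increasing_seqP: incr; apply.
move=> P [m _ mP]; exists m => // k /= mk; apply: mP => /=.
exact: leq_trans mk (phi_ge k).
Qed.

(** Subsequences are extracted one coordinate after the other, so that a single
    reindexing serves all of them. *)
Lemma bounded_seq_subcvg n (s : 'I_n -> nat -> R) :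
  (forall i, bounded_seq (s i)) ->
  exists2 phi : nat -> nat, phi @ \oo --> \oo &
    forall i, exists l : R, s i \o phi @ \oo --> l.
Proof.
elim: n s => [|n IHn] s sb.
  by exists id => [|[]//]; exact: cvg_id.
have [phi phioo phil] := IHn (fun i => s (lift ord0 i)) (fun i => sb _).
have [|psi /increasing_seq_cvg psioo /cvg_ex [l sl]] :=
  @bolzano_weierstrass R (s ord0 \o phi).
  have [C sC] := sb ord0; exists C; split; first exact: num_real.
  by move=> x Cx k _; exact: le_trans (sC _) (ltW Cx).
exists (phi \o psi) => [|i]; first exact: cvg_comp psioo phioo.
have [j ->|->] := unliftP ord0 i; last by exists l.
by have [m ml] := phil j; exists m; exact: cvg_comp psioo ml.
Qed.

Lemma bounded_vec_subcvg n (xs : nat -> 'cV[R]_n) :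
  (forall i, bounded_seq (fun k => xs k i 0)) ->
  exists2 phi : nat -> nat, phi @ \oo --> \oo &
    exists x : 'cV[R]_n, (fun k => xs (phi k)) @ \oo --> x.
Proof.
move=> xb; have [phi phioo /choice [l xl]] := bounded_seq_subcvg xb.
exists phi => //; exists (\col_i l i); apply/cvg_coordP => i; rewrite mxE.
exact: xl.
Qed.

End EuclideanTheory.

(** * Linearization, subgradients and normals *)

Section Subgradients.
Context {R : realType}.

(** A quadratic bound on the error, rather than mere differentiability, is stable
    under sums by adding constants, and all smooth terms of the objective and
    of the augmented Lagrangian are quadratic in each block of variables. *)
Definition linearizes n (f : 'cV[R]_n -> R) (x a : 'cV[R]_n) :=
  exists2 C, 0 <= C &
    forall y, `|f y - f x - dot a (y - x)| <= C * enorm (y - x) ^+ 2.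

Lemma linearizes_affine n (f : 'cV[R]_n -> R) x a :
  (forall y, f y - f x = dot a (y - x)) -> linearizes f x a.
Proof.
by move=> fa; exists 0 => // y; rewrite fa subrr normr0 mul0r.
Qed.

Lemma linearizesD n (f g : 'cV[R]_n -> R) x a b :
  linearizes f x a -> linearizes g x b ->
  linearizes (fun y => f y + g y) x (a + b).
Proof.
move=> [C C0 fC] [D D0 gD]; exists (C + D) => [|y]; first exact: addr_ge0.
rewrite mulrDl; apply: le_trans (lerD (fC y) (gD y)).
by apply: le_trans (ler_normD _ _); rewrite dotDl le_eqVlt; apply/orP; left;
  apply/eqP; congr `| _ |; ring.
Qed.

Lemma linearizesZ n (f : 'cV[R]_n -> R) c x a :
  linearizes f x a -> linearizes (fun y => c * f y) x (c *: a).
Proof.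
move=> [C C0 fC]; exists (`|c| * C) => [|y]; first exact: mulr_ge0.
by rewrite dotZl -!mulrBr normrM -mulrA ler_wpM2l.
Qed.

Lemma linearizes_cst n c (x : 'cV[R]_n) : linearizes (fun=> c) x 0.
Proof. by apply: linearizes_affine => y; rewrite subrr dot0l. Qed.

Lemma linearizes_sum n m (f : 'I_m -> 'cV[R]_n -> R) x a :
  (forall i, linearizes (f i) x (a i)) ->
  linearizes (fun y => \sum_i f i y) x (\sum_i a i).
Proof.
move=> fa; rewrite (_ : (fun y => _) = \sum_i f i); last first.
  by apply/funext => y; rewrite fct_sumE.
apply: (big_ind2 (fun g b => linearizes g x b)) => [|g b h c gb hc|i _].
- exact: linearizes_cst.
- exact: linearizesD.
- exact: fa.
Qed.

Lemma eq_linearizes n (f g : 'cV[R]_n -> R) x a b :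
  f =1 g -> a = b -> linearizes f x a -> linearizes g x b.
Proof. by move=> /funext -> ->. Qed.

(** A penalized linear constraint: the multiplier it feeds back to the
    variable is the shifted one, [xi + rho *: r x]. *)
Lemma linearizes_penalty m n (r : 'cV[R]_n -> 'cV[R]_m) (M : 'M[R]_(m, n))
    (xi : 'cV[R]_m) (rho : R) x :
  (forall y, r y - r x = M *m (y - x)) ->
  linearizes (fun y => dot xi (r y) + rho / 2 * enorm (r y) ^+ 2) x
    (M^T *m (xi + rho *: r x)).
Proof.
move=> rM; have [C C0 MC] := enorm_mulmx_le M.
exists (`|rho| * C) => [|y]; first by rewrite mulr_ge0.
have -> : r y = r x + M *m (y - x) by rewrite -rM addrC subrK.
move: (MC (y - x)); rewrite -dot_mulmx !sqr_enorm.
move: (M *m (y - x)) => z zC.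
move: (y - x) zC => v zC; rewrite !dotDl !dotDr !dotZl [dot z (r x)]dotC.
rewrite (_ : _ - _ = rho / 2 * dot z z); last by field.
rewrite !normrM -!mulrA ler_wpM2l //; apply: le_trans zC.
rewrite [X in _ * X]ger0_norm ?dot_ge0 // -[leRHS]mul1r ler_wpM2r ?dot_ge0 //.
by rewrite ger0_norm ?invr_ge0 // invf_le1 // ler1n.
Qed.

Lemma linearizes_sqr_coord n i c (x : 'cV[R]_n) :
  linearizes (fun y => (y i 0 - c) ^+ 2) x
    ((2 * (x i 0 - c)) *: delta_mx i 0).
Proof.
exists 1 => // y; rewrite mul1r dotZl dotC dot_delta !mxE.
rewrite (_ : _ - _ = ((y - x) i 0) ^+ 2); last by rewrite !mxE; ring.
rewrite normrX ler_sqr ?nnegrE ?enorm_ge0 //; exact: coord_le_enorm.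
Qed.

Lemma grad_linearizes n (f : 'cV[R]_n -> R) x a :
  linearizes f x a -> grad f x = a.
Proof.
move=> [C C0 fC]; apply/colP => i; rewrite mxE /derive.
apply: cvg_lim => //; apply/cvgrPdist_le => e e0.
near=> h; have h0 : h != 0 by near: h; exact: nbhs_dnbhs_neq.
have := fC (h *: delta_mx i 0 + x).
rewrite addrK dotZr dot_delta enormZ exprMn.
have -> : enorm (delta_mx i 0 : 'cV[R]_n) ^+ 2 = 1.
  by rewrite sqr_enorm dot_delta mxE !eqxx.
rewrite mulr1 /= => H.
rewrite distrC /GRing.scale /=.
rewrite (_ : _ - _ = h^-1 * (f (h *: delta_mx i 0 + x) - f x - h * a i 0));
  last by rewrite !mulrBr mulKf.
rewrite normrM normfV ler_pdivrMl ?normr_gt0 //; apply: (le_trans H).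
rewrite expr2 mulrA mulrC ler_wpM2l //.
have : `|h| <= e / (C + 1).
  near: h; apply: dnbhs0_le; rewrite divr_gt0 // ltr_wpDl //.
rewrite ler_pdivlMr ?ltr_wpDl // => He; apply: le_trans He.
by rewrite mulrC ler_wpM2l // lerDl.
Unshelve. all: by end_near. Qed.

(** A smooth summand shifts the Frechet subdifferential by its gradient. The
    upper quadratic bound suffices: near [x] it is absorbed by half of the
    allowed error [e * enorm (y - x)]. *)
Lemma frechet_subdiffD n (f q : 'cV[R]_n -> R) x g a :
  frechet_subdiff (fun y => f y + q y) x g -> linearizes q x a ->
  frechet_subdiff f x (g - a).
Proof.
move=> fg [C C0 qC] e e0.
have e2 : 0 < e / 2 by rewrite divr_gt0.
have : \forall y \near x, enorm (y - x) < e / 2 / (C + 1).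
  apply/near_enormP; exists (e / 2 / (C + 1)) => //.
  by rewrite divr_gt0 // ltr_wpDl.
have := fg _ e2; apply: filterS2 => y Hf yx.
have Hq := le_trans (ler_norm _) (qC y).
have : C * enorm (y - x) ^+ 2 <= e / 2 * enorm (y - x).
  rewrite expr2 mulrA ler_wpM2r ?enorm_ge0 //.
  move: yx; rewrite ltr_pdivlMr ?ltr_wpDl // => /ltW; apply: le_trans.
  by rewrite mulrC ler_wpM2l ?enorm_ge0 // lerDl.
rewrite dotBl; lra.
Qed.

Lemma frechet_subdiff_ray n (f : 'cV[R]_n -> R) x g v e :
  frechet_subdiff f x g -> 0 < e ->
  exists2 t, 0 < t & f x + t * dot g v - e * t * enorm v <= f (x + t *: v).
Proof.
move=> fg e0; have /near_enormP [r r0 H] := fg _ e0.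
exists (r / (enorm v + 1)); first by rewrite divr_gt0 // ltr_wpDl ?enorm_ge0.
set t := r / _; have t0 : 0 < t by rewrite divr_gt0 // ltr_wpDl ?enorm_ge0.
have := H (x + t *: v); rewrite addrC addKr dotZr enormZ gtr0_norm // mulrA.
apply; rewrite /t mulrAC ltr_pdivrMr ?ltr_wpDl ?enorm_ge0 //.
by rewrite ltr_pM2l // ltrDl.
Qed.

Lemma frechet_subdiff_linearizes n (f : 'cV[R]_n -> R) x g a :
  frechet_subdiff f x g -> linearizes f x a -> g = a.
Proof.
move=> fg fa.
have /frechet_subdiffD /(_ fa) fga : frechet_subdiff (fun y => 0 + f y) x g.
  by move=> e /fg; apply: filterS => y; rewrite !add0r.
apply/eqP; rewrite -subr_eq0; move: (g - a) fga => {fg fa}g fg.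
apply/eqP; apply/colP => i; rewrite [RHS]mxE.
apply/eqP; rewrite -normr_le0; apply: (le_trans (coord_le_enorm _ _)).
apply/ler_addgt0Pr => e e0; rewrite add0r.
have [t t0] := frechet_subdiff_ray g fg e0.
rewrite add0r subr_le0 -sqr_enorm -mulrA [e * (t * _)]mulrCA ler_pM2l //.
have [->|n0] := eqVneq (enorm g) 0; first by move=> _; rewrite ltW.
by rewrite expr2 ler_pM2r // lt_neqAle eq_sym n0 enorm_ge0.
Qed.

(** Used with an affine isometric embedding [h] that moves a single block of
    variables: the partial subgradient is the corresponding block of [g]. *)
Lemma frechet_subdiff_comp m n (f : 'cV[R]_n -> R) (h : 'cV[R]_m -> 'cV[R]_n)
    x g g' :
  (forall y, enorm (h y - h x) = enorm (y - x)) ->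
  (forall y, dot g (h y - h x) = dot g' (y - x)) ->
  frechet_subdiff f (h x) g -> frechet_subdiff (fun y => f (h y)) x g'.
Proof.
move=> hE hg fg e e0; have /near_enormP [r r0 H] := fg _ e0.
apply/near_enormP; exists r => // y yx.
by rewrite -hg -hE; apply: H; rewrite hE.
Qed.

(** Only the growth of [f] along one coordinate axis matters, so the bound is
    available coordinate by coordinate. *)
Lemma frechet_subdiff_coord_le n (f : 'cV[R]_n -> R) x g i C :
  (forall t, f (x + t *: delta_mx i 0) - f x <= C * `|t|) ->
  frechet_subdiff f x g -> `|g i 0| <= C.
Proof.
move=> fC fg.
have key (s : R) : `|s| = 1 -> s * g i 0 <= C.
  move=> s1; apply/ler_addgt0Pr => e e0.
  have [t t0] := frechet_subdiff_ray (s *: delta_mx i 0) fg e0.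
  have -> : enorm (s *: delta_mx i 0 : 'cV[R]_n) = 1.
    by rewrite enormZ s1 /enorm dot_delta mxE !eqxx sqrtr1 mulr1.
  have := fC (t * s); rewrite -scalerA normrM s1 mulr1 gtr0_norm //.
  rewrite dotZr dot_delta mulr1 => H1 H2; rewrite -(ler_pM2r t0) mulrDl; lra.
rewrite ler_norml lerNl -mulN1r; apply/andP; split.
  by apply: key; rewrite normrN1.
by rewrite -[g i 0]mul1r; apply: key; rewrite normr1.
Qed.

Lemma frechet_normal_ray n (S : set 'cV[R]_n) x g v r :
  0 < r -> (forall t, 0 < t <= r -> S (x + t *: v)) ->
  frechet_normal S x g -> dot g v <= 0.
Proof.
move=> r0 Sv [_ Sg]; have n1 : 0 < enorm v + 1 by rewrite ltr_wpDl ?enorm_ge0.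
apply/ler_addgt0Pr => e e0; rewrite add0r.
have /Sg /near_enormP [s s0 H] : 0 < e / (enorm v + 1) by rewrite divr_gt0.
pose t := Num.min r (s / (enorm v + 1)).
have t0 : 0 < t by rewrite lt_min r0 divr_gt0.
have ts : t * enorm v < s.
  apply: (@le_lt_trans _ _ (s / (enorm v + 1) * enorm v)).
    by rewrite ler_wpM2r ?enorm_ge0 // ge_min lexx orbT.
  by rewrite mulrAC ltr_pdivrMr // ltr_pM2l // ltrDl.
have := H (x + t *: v); rewrite addrC addKr dotZr enormZ gtr0_norm //.
move=> /(_ ts).
have /Sv Sx : 0 < t <= r by rewrite t0 ge_min lexx.
move=> /(_ Sx); rewrite mulrCA ler_pM2l // => /le_trans; apply.
by rewrite mulrAC ler_pdivrMr // ler_pM2l // lerDl.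
Qed.

(** Instead of a calculus of limiting subdifferentials, nearby Frechet
    subgradients and normals are used: they decompose exactly, and they are
    just as good once a limit is taken. *)
Lemma limiting_subdiff_near n (f : 'cV[R]_n -> R) x g e :
  limiting_subdiff f x g -> 0 < e ->
  exists x' g', [/\ frechet_subdiff f x' g', enorm (x' - x) < e
                  & enorm (g' - g) < e].
Proof.
move=> [xs [gs [xx _ fg gg]]] e0.
have [k [xk gk]] : exists k, enorm (xs k - x) < e /\ enorm (gs k - g) < e.
  near \oo => k; exists k; split; near: k; exact: cvg_enorm_lt.
by exists (xs k), (gs k).
Unshelve. all: by end_near. Qed.

Lemma limiting_normal_near n (S : set 'cV[R]_n) x g e :
  limiting_normal S x g -> 0 < e ->
  exists x' g', [/\ frechet_normal S x' g', enorm (x' - x) < e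
                  & enorm (g' - g) < e].
Proof.
move=> [_ [xs [gs [xx fg gg]]]] e0.
have [k [xk gk]] : exists k, enorm (xs k - x) < e /\ enorm (gs k - g) < e.
  near \oo => k; exists k; split; near: k; exact: cvg_enorm_lt.
by exists (xs k), (gs k).
Unshelve. all: by end_near. Qed.

Lemma dist_to_ge0 n (x : 'cV[R]_n) S : (0 <= dist_to x S)%E.
Proof. by apply/ereal_infP => _ [y _ <-]; rewrite lee_fin enorm_ge0. Qed.

Lemma dist_to_le n (x y : 'cV[R]_n) (S : set 'cV[R]_n) :
  S y -> (dist_to x S <= (enorm (x - y))%:E)%E.
Proof. by move=> Sy; apply: ereal_inf_lbound; exists y. Qed.

Lemma dist_to_attained n (x : 'cV[R]_n) (S : set 'cV[R]_n) c e :
  (dist_to x S <= c%:E)%E -> 0 < e -> exists2 y, S y & enorm (x - y) <= c + e.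
Proof.
move=> Sc e0.
have dfin : dist_to x S \is a fin_num.
  by rewrite ge0_fin_numE ?dist_to_ge0 // (le_lt_trans Sc) // ltry.
have [_ [y Sy <-] yc] := lb_ereal_inf_adherent e0 dfin.
exists y => //; rewrite -lee_fin EFinD; apply: (le_trans (ltW yc)).
exact: leeD.
Qed.

Lemma limn_einf_eq0 (s : nat -> \bar R) :
  (forall k, (0 <= s k)%E) ->
  (forall e m, 0 < e -> exists2 k, (m <= k)%N & (s k <= e%:E)%E) ->
  limn_einf s = 0%E.
Proof.
move=> s0 sle; rewrite limn_einf_lim.
rewrite (_ : einfs s = cst 0%E) ?lim_cst //; apply/funext => m /=.
apply/eqP; rewrite eq_le; apply/andP; split; last first.
  by apply/ereal_infP => _ [k _ <-].
apply/lee_addgt0Pr => e e0; rewrite add0e; have [k mk ke] := sle _ m e0.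
by apply: ge_ereal_inf; exists (s k) => //; exists k.
Qed.

End Subgradients.

(** * The network *)

Section NetworkTheory.
Context {R : realType} {L N : nat} {d : nat -> nat}.
Local Notation cvW := 'cV[R]_(dim_w L d).
Local Notation cvB := 'cV[R]_(dim_b L d).
Local Notation cvV := 'cV[R]_(dim_v L N d).
Local Notation Psi := (@Defs.Psi R L N d).
Local Notation Amx := (@Defs.Amx R L N d).
Local Notation weight := (@Defs.weight R L d).
Local Notation layer := (@Defs.layer R L N d).
Local Notation layer_input := (@Defs.layer_input R L N d).
Implicit Types (X : 'M[R]_(d 0%N, N)) (Y : 'M[R]_(d L.+1, N)).
Implicit Types (w : cvW) (b : cvB) (u v x y : cvV).

Local Notation widx := (@tagnat.Rank L.+1 (fun l => d l * d l.+1)%N).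
Local Notation bidx := (@tagnat.Rank L.+1 (fun l => d l.+1)%N).
Local Notation vidx := (@tagnat.Rank L.+1 (fun l => N * d l.+1)%N).

Lemma weightE w l i j : weight w l i j = w (widx l (mxtens_index (j, i))) 0.
Proof. by rewrite !mxE. Qed.

Lemma layerE v l i n : layer v l i n = v (vidx l (mxtens_index (n, i))) 0.
Proof. by rewrite !mxE. Qed.

(** Coordinates of the stacked vectors are handled through their layer, sample
    and neuron. *)
Variant vidx_spec : 'I_(dim_v L N d) -> Type :=
  VidxSpec (l : 'I_L.+1) (n : 'I_N) (i : 'I_(d l.+1)) :
    vidx_spec (vidx l (mxtens_index (n, i))).

Lemma vidxP k : vidx_spec k.
Proof.
by rewrite -[k]tagnat.sig2K; case: (mxtens_indexP (tagnat.sig2 k)).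
Qed.

Lemma Psi_mulmxE X v w (l : 'I_L.+1) n (i : 'I_(d l.+1)) :
  (Psi X v *m w) (vidx l (mxtens_index (n, i))) 0
  = \sum_j weight w l i j * layer_input X v l j n.
Proof.
have := congr1 (fun M : 'cV[R]_(N * d l.+1) => M (mxtens_index (n, i)) 0)
  (@Psi_Amx_block R L N d X w 0 v l).
rewrite /=.
rewrite mulmx0 addr0 submxcol0 mul0mx addr0.
by rewrite [LHS]mxE => ->; rewrite mxE mxtens_indexK mxE.
Qed.

Lemma Amx_mulmxE b (l : 'I_L.+1) n (i : 'I_(d l.+1)) :
  (Amx *m b : cvV) (vidx l (mxtens_index (n, i))) 0 = b (bidx l i) 0.
Proof.
have := congr1 (fun M : 'cV[R]_(N * d l.+1) => M (mxtens_index (n, i)) 0)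
  (@Psi_Amx_block R L N d 0 0 b 0 l).
rewrite /=.
rewrite mulmx0 add0r [LHS]mxE => ->.
rewrite mxE mxtens_indexK mxE !mxE /= big1 ?add0r => [|k _].
  by rewrite big_ord1 !mxE mulr1.
by rewrite weightE mxE mul0r.
Qed.

(** The biases can be read off from the values they add to the layers. *)
Lemma Amx_left_inverse (hN : (0 < N)%N) k :
  exists j, forall b, (Amx *m b : cvV) j 0 = b k 0.
Proof.
exists (vidx _ (mxtens_index (Ordinal hN, tagnat.sig2 k))) => b.
by rewrite Amx_mulmxE tagnat.sig2K.
Qed.

(** The matrix of the linear part of the affine map [v |-> Psi X v *m w]: with
    the inputs set to zero, only that linear part remains. *)
Definition Psi_deriv w : 'M[R]_(dim_v L N d) :=
  \matrix_(j, k) (Psi 0 (delta_mx k 0) *m w) j 0.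

Lemma layer_inputS X v l (hl : (l.+1 < L.+1)%N) i n :
  layer_input X v (Ordinal hl) i n
  = v (vidx (Ordinal (ltnW hl)) (mxtens_index (n, i))) 0.
Proof. exact: layerE. Qed.

Lemma layer_inputB X x y (l : 'I_L.+1) i n :
  layer_input X y l i n - layer_input X x l i n
  = \sum_k layer_input 0 (delta_mx k 0) l i n * (y - x) k 0.
Proof.
case: l i => [[|l] hl] i.
  by rewrite subrr big1 // => k _; rewrite mxE mul0r.
rewrite !layer_inputS; set K := vidx _ _.
rewrite (bigD1 K) // [X in _ = _ + X]big1 ?addr0 => [|k kK].
  by rewrite layer_inputS -/K 2!mxE !eqxx mul1r !mxE.
by rewrite layer_inputS -/K mxE eq_sym (negbTE kK) mul0r.
Qed.

Lemma Psi_mulmxB X w x y :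
  Psi X y *m w - Psi X x *m w = Psi_deriv w *m (y - x).
Proof.
apply/colP => k; case: (vidxP k) => l n i.
rewrite [RHS]mxE; transitivity (\sum_k' \sum_j
    weight w l i j * (layer_input 0 (delta_mx k' 0) l j n * (y - x) k' 0)).
  rewrite [RHS]exchange_big /= [LHS]mxE [X in _ + X]mxE !Psi_mulmxE -sumrB.
  by apply: eq_bigr => j _; rewrite -mulrBr (layer_inputB X) mulr_sumr.
apply: eq_bigr => k' _; rewrite [Psi_deriv _ _ _]mxE Psi_mulmxE mulr_suml.
by apply: eq_bigr => j _; rewrite mulrA.
Qed.

Lemma Psi_mulmx_split X w v : Psi X v *m w = Psi X 0 *m w + Psi_deriv w *m v.
Proof. by rewrite -[v in RHS]subr0 -(Psi_mulmxB X) addrC subrK. Qed.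

Definition layer_of (k : 'I_(dim_v L N d)) : 'I_L.+1 := tagnat.sig1 k.

(** Each layer feeds the next one only: this is what makes the adjoint system
    solvable from the last layer backwards. *)
Lemma Psi_deriv_next w j k :
  Psi_deriv w j k != 0 -> layer_of j = (layer_of k).+1 :> nat.
Proof.
rewrite mxE; case: (vidxP j) => l n i; apply: contra_neq_eq.
rewrite Psi_mulmxE /layer_of tagnat.Rank1K => lk.
rewrite big1 // => m _.
suff -> : layer_input 0 (delta_mx k 0) l m n = 0 by rewrite mulr0.
case: l => [[|l] hl] in i m lk *; first by rewrite mxE.
rewrite layer_inputS mxE; case: eqP => // kE; move: lk.
by rewrite -kE tagnat.Rank1K /= eqxx.
Qed.

Lemma cvg_Psi_deriv (ws : nat -> cvW) w : ws @ \oo --> w ->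
  forall j k, (fun n => Psi_deriv (ws n) j k) @ \oo --> Psi_deriv w j k.
Proof.
move=> wsw j k; rewrite mxE; under eq_cvg do rewrite mxE.
move: j; apply/cvg_coordP.
by apply: cvg_mulmx => // ? ?; exact: cvg_cst.
Qed.

Lemma cvg_Psi X (xs : nat -> cvV) x : xs @ \oo --> x ->
  forall i j, (fun n => Psi X (xs n) i j) @ \oo --> Psi X x i j.
Proof.
have entry v i j :
    Psi X v i j = (Psi X 0 *m delta_mx j 0 + Psi_deriv (delta_mx j 0) *m v) i 0.
  by rewrite -Psi_mulmx_split -colE [RHS]mxE.
move=> xx i j; rewrite entry; under eq_cvg do rewrite entry.
move: i; apply/cvg_coordP; apply: cvgD; first exact: cvg_cst.
by apply: cvg_mulmx => // ? ?; exact: cvg_cst.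
Qed.

Lemma cvg_residual X (ws : nat -> cvW) (bs : nat -> cvB) (vs us : nat -> cvV)
    w b v u :
  ws @ \oo --> w -> bs @ \oo --> b -> vs @ \oo --> v -> us @ \oo --> u ->
  (fun k => residual X (ws k) (bs k) (vs k) (us k)) @ \oo
    --> residual X w b v u.
Proof.
move=> cw cb cv cu; apply: cvgB; first apply: cvgB => //.
  by apply: cvg_mulmx => //; exact: cvg_Psi.
by apply: cvg_mulmx => // ? ?; exact: cvg_cst.
Qed.

(** ** The objective *)

Lemma reg1_ge0 lw w : 0 < lw -> 0 <= reg1 lw w.
Proof.
move=> lw0; apply: mulr_ge0; first exact: ltW.
apply: sumr_ge0 => l _; apply: sumr_ge0 => j _; exact: enorm_ge0.
Qed.

Lemma reg1_coord_le lw w k : 0 < lw -> lw * `|w k 0| <= reg1 lw w.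
Proof.
move=> /ltW lw0; rewrite ler_wpM2l //.
rewrite -[k]tagnat.sig2K; case: (mxtens_indexP (tagnat.sig2 k)) => j i.
rewrite -weightE; move: (weight w) (tagnat.sig1 k) i j => M l i j.
have nn l' j' : 0 <= enorm (col j' (M l')) := enorm_ge0 _.
rewrite (bigD1 l) //= (bigD1 j) //= -addrA ler_wpDr //.
  by rewrite addr_ge0 // sumr_ge0 // => l' _; rewrite sumr_ge0.
by apply: le_trans (coord_le_enorm _ i); rewrite mxE.
Qed.

Lemma cvg_reg1 lw (ws : nat -> cvW) w :
  ws @ \oo --> w -> (fun k => reg1 lw (ws k)) @ \oo --> reg1 lw w.
Proof.
move=> /cvg_coordP ww; apply: cvgM; first exact: cvg_cst.
apply: (@cvg_sumr R _ (fun l k => \sum_(j < d l) enorm (col j (weight (ws k) l)))).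
move=> l; apply: (@cvg_sumr R _ (fun j k => enorm (col j (weight (ws k) l)))).
move=> j; apply: cvg_enorm; apply/cvg_coordP => i.
by rewrite mxE weightE; under eq_cvg do rewrite mxE weightE; exact: ww.
Qed.

Lemma beta_vecE (beta : 'I_L.+1 -> R) k :
  (beta_vec beta : cvV) k 0 = beta (layer_of k).
Proof. by rewrite !mxE. Qed.

(** The gradient in [v] of [obj_bar]; the regularization of [w] is a separate
    term, so that [w] does not occur in it. *)
Definition obj_bar_grad Y lv v : cvV :=
  N%:R^-1 *: (\sum_(n < N) \sum_i
      (2 * (layer v ord_max i n - Y i n)) *:
        delta_mx (vidx ord_max (mxtens_index (n, i))) 0)
  + lv *: (\sum_k (2 * v k 0) *: delta_mx k 0).

Lemma obj_bar_linearizes Y lw lv w v :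
  linearizes (obj_bar Y lw lv w) v (obj_bar_grad Y lv v).
Proof.
rewrite /obj_bar_grad -[X in X + _]addr0.
apply: linearizesD; first apply: linearizesD.
- apply: linearizesZ.
  pose f n i (y : cvV) :=
    (y (vidx ord_max (mxtens_index (n, i))) 0 - Y i n) ^+ 2.
  apply: (@eq_linearizes _ _ (fun y => \sum_n \sum_i f n i y)) => [y|//|].
    apply: eq_bigr => n _; rewrite sqr_enorm; apply: eq_bigr => i _.
    by rewrite !mxE.
  apply: linearizes_sum => n; apply: linearizes_sum => i.
  by rewrite layerE; exact: linearizes_sqr_coord.
- exact: linearizes_cst.
apply: linearizesZ.
apply: (@eq_linearizes _ _ (fun y : cvV => \sum_k (y k 0 - 0) ^+ 2)) => [y|//|].
  by rewrite sqr_enorm; apply: eq_bigr => k _; rewrite subr0 expr2.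
by apply: linearizes_sum => k; rewrite -[v k 0]subr0; exact: linearizes_sqr_coord.
Qed.

Lemma cvg_obj_bar_grad Y lv (vs : nat -> cvV) v :
  vs @ \oo --> v ->
  (fun k => obj_bar_grad Y lv (vs k)) @ \oo --> obj_bar_grad Y lv v.
Proof.
move=> /cvg_coordP vv.
have cvg_sum_mx n (f : 'I_n -> nat -> cvV) (l : 'I_n -> cvV) :
    (forall i, f i @ \oo --> l i) ->
    (fun k => \sum_i f i k) @ \oo --> \sum_i l i.
  move=> fl; apply/cvg_coordP => j; rewrite summxE.
  under eq_cvg do rewrite summxE.
  apply: (@cvg_sumr R n (fun i k => f i k j 0)) => i.
  by move: j; apply/cvg_coordP; exact: fl.
apply: cvgD; apply: cvgZ; try exact: cvg_cst.
  apply: (cvg_sum_mx) => n; apply: (cvg_sum_mx) => i.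
  apply: cvgZ; last exact: cvg_cst.
  apply: cvgM; first exact: cvg_cst.
  apply: cvgB; last exact: cvg_cst.
  by rewrite layerE; under eq_cvg do rewrite layerE; exact: vv.
apply: cvg_sum_mx => k; apply: cvgZ; last exact: cvg_cst.
by apply: cvgM; [exact: cvg_cst|exact: vv].
Qed.

End NetworkTheory.

(** * Subgradients and normals at a point *)

Section Stationarity.
Context {R : realType} {L N : nat} {d : nat -> nat}.
Local Notation cvW := 'cV[R]_(dim_w L d).
Local Notation cvB := 'cV[R]_(dim_b L d).
Local Notation cvV := 'cV[R]_(dim_v L N d).
Local Notation cvZ := 'cV[R]_(dim_z L N d).
Local Notation Psi := (@Defs.Psi R L N d).
Local Notation Amx := (@Defs.Amx R L N d).
Local Notation Psi_deriv := (@Psi_deriv R L N d).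
Local Notation stack := (@Defs.stack R L N d).
Implicit Types (X : 'M[R]_(d 0%N, N)) (Y : 'M[R]_(d L.+1, N)).
Implicit Types (w : cvW) (b : cvB) (u v : cvV) (z g h : cvZ).

Definition w_part z : cvW := usubmx (usubmx z).
Definition b_part z : cvB := dsubmx (usubmx z).
Definition v_part z : cvV := usubmx (dsubmx z).
Definition u_part z : cvV := dsubmx (dsubmx z).

Lemma stack_parts z : stack (w_part z) (b_part z) (v_part z) (u_part z) = z.
Proof. by rewrite /stack !vsubmxK. Qed.

Lemma v_partD z z' : v_part (z + z') = v_part z + v_part z'.
Proof. by rewrite /v_part !linearD. Qed.
Lemma u_partD z z' : u_part (z + z') = u_part z + u_part z'.
Proof. by rewrite /u_part !linearD. Qed.
Lemma w_partD z z' : w_part (z + z') = w_part z + w_part z'.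
Proof. by rewrite /w_part !linearD. Qed.
Lemma b_partD z z' : b_part (z + z') = b_part z + b_part z'.
Proof. by rewrite /b_part !linearD. Qed.

Lemma on_stackE T (f : cvW -> cvB -> cvV -> cvV -> T) w b v u :
  on_stack d f (stack w b v u) = f w b v u.
Proof. by rewrite /on_stack /stack !(col_mxKu, col_mxKd). Qed.

Lemma w_part_stack w b v u : w_part (stack w b v u) = w.
Proof. by rewrite /w_part /stack !(col_mxKu, col_mxKd). Qed.
Lemma b_part_stack w b v u : b_part (stack w b v u) = b.
Proof. by rewrite /b_part /stack !(col_mxKu, col_mxKd). Qed.
Lemma v_part_stack w b v u : v_part (stack w b v u) = v.
Proof. by rewrite /v_part /stack !(col_mxKu, col_mxKd). Qed.
Lemma u_part_stack w b v u : u_part (stack w b v u) = u.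
Proof. by rewrite /u_part /stack !(col_mxKu, col_mxKd). Qed.
Definition part_stack := (w_part_stack, b_part_stack, v_part_stack, u_part_stack).

Lemma cvg_stack (ws : nat -> cvW) (bs : nat -> cvB) (vs us : nat -> cvV) w b v u :
  (fun k => stack (ws k) (bs k) (vs k) (us k)) @ \oo --> stack w b v u <->
  [/\ ws @ \oo --> w, bs @ \oo --> b, vs @ \oo --> v & us @ \oo --> u].
Proof.
split=> [/cvg_col_mx[/cvg_col_mx[? ?] /cvg_col_mx[? ?]]|[? ? ? ?]].
  by split.
by do ![apply/cvg_col_mx; split].
Qed.

Lemma cvg_parts (zs : nat -> cvZ) z : zs @ \oo --> z ->
  [/\ (fun k => w_part (zs k)) @ \oo --> w_part z,
      (fun k => b_part (zs k)) @ \oo --> b_part z,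
      (fun k => v_part (zs k)) @ \oo --> v_part z
    & (fun k => u_part (zs k)) @ \oo --> u_part z].
Proof.
move=> zz; apply/cvg_stack; rewrite stack_parts.
by under eq_cvg do rewrite stack_parts.
Qed.

Lemma dot_stack g w b v u :
  dot g (stack w b v u)
  = dot (w_part g) w + dot (b_part g) b + dot (v_part g) v + dot (u_part g) u.
Proof. by rewrite -{1}[g]stack_parts !dot_col_mx addrA. Qed.

Lemma stackD w b v u w' b' v' u' :
  stack w b v u + stack w' b' v' u' = stack (w + w') (b + b') (v + v') (u + u').
Proof. by rewrite /stack !add_col_mx. Qed.

Lemma stackN w b v u : - stack w b v u = stack (- w) (- b) (- v) (- u).
Proof. by rewrite /stack !opp_col_mx. Qed.

Lemma stackZ a w b v u :
  a *: stack w b v u = stack (a *: w) (a *: b) (a *: v) (a *: u).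
Proof. by rewrite /stack !scale_col_mx. Qed.

Lemma enorm_stack w b v u :
  enorm (stack w b v u)
  = Num.sqrt (dot w w + dot b b + dot v v + dot u u).
Proof. by rewrite /enorm dot_stack !part_stack. Qed.

(** ** The activation *)

Context (alpha : R) (beta : 'I_L.+1 -> R).
Context (halpha : 0 < alpha < 1) (hbeta : forall l, 0 < beta l).

Let alpha_gt0 : 0 < alpha. Proof. by case/andP: halpha. Qed.
Let alpha_lt1 : alpha < 1. Proof. by case/andP: halpha. Qed.

Lemma sigmaE n (x : 'cV[R]_n) i :
  sigma alpha x i 0 = Num.max (x i 0) (alpha * x i 0).
Proof. by rewrite mxE. Qed.

Lemma leaky_lipschitz (s t : R) :
  `|Num.max t (alpha * t) - Num.max s (alpha * s)| <= `|t - s|.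
Proof.
have a1 := alpha_lt1; have a0 := alpha_gt0.
wlog st : s t / s <= t => [H|].
  have [/H//|/ltW/H] := leP s t; by rewrite distrC [leRHS]distrC.
rewrite [leRHS]ger0_norm ?subr_ge0 // ler_norml.
by apply/andP; split; case: (leP t (alpha * t)) => ?;
  case: (leP s (alpha * s)) => ?; nra.
Qed.

Lemma cvg_sigma n (xs : nat -> 'cV[R]_n) (x : 'cV[R]_n) :
  xs @ \oo --> x -> (fun k => sigma alpha (xs k)) @ \oo --> sigma alpha x.
Proof.
move=> xx; apply/cvg_coordP => i; rewrite sigmaE.
under eq_cvg do rewrite sigmaE.
apply/cvgrPdist_lt => e e0.
apply: filterS (cvg_enorm_lt xx e0) => k; apply: le_lt_trans.
rewrite distrC; apply: (le_trans (leaky_lipschitz _ _)).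
by have := coord_le_enorm (xs k - x) i; rewrite !mxE.
Qed.

Local Notation activation_gain :=
  (fun u' : cvV => - dot (beta_vec beta) (sigma alpha u')).

Lemma cvg_activation_gain (us : nat -> cvV) u :
  us @ \oo --> u ->
  (fun k => - dot (beta_vec beta) (sigma alpha (us k))) @ \oo
    --> - dot (beta_vec beta) (sigma alpha u).
Proof.
by move=> uu; apply: cvgN; apply: cvg_dot; [exact: cvg_cst|exact: cvg_sigma].
Qed.

Lemma activation_subgradient_le u s i :
  frechet_subdiff activation_gain u s -> `|s i 0| <= beta (layer_of i).
Proof.
apply: frechet_subdiff_coord_le => t.
rewrite opprK addrC -dotBr -[leRHS]ger0_norm; last first.
  by rewrite mulr_ge0 // ltW.
have BE (x y : cvV) j : (x - y) j 0 = x j 0 - y j 0 by rewrite !mxE.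
have DE j : (u + t *: delta_mx i 0) j 0 = u j 0 + t * (j == i)%:R.
  by rewrite !mxE eqxx andbT.
rewrite /dot (bigD1 i) //= [X in _ + X]big1 => [|j ji]; last first.
  by rewrite BE !sigmaE DE (negbTE ji) mulr0 addr0 subrr mulr0.
rewrite addr0 beta_vecE BE !sigmaE DE eqxx mulr1.
apply: (le_trans (ler_norm _)); rewrite !normrM normr_id ler_wpM2l //.
by apply: (le_trans (leaky_lipschitz _ _)); rewrite opprD addNKr normrN.
Qed.

(** ** Normals to the constraint set *)

Lemma Omega3P w b v u :
  Omega3 alpha w b v u <->
  forall i, u i 0 <= v i 0 /\ alpha * u i 0 <= v i 0.
Proof.
split=> [H i|H i].
  have := H (lshift _ i); have := H (rshift _ i).
  by rewrite col_mxEu col_mxEd !mxE !subr_le0.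
by case: (split_ordP i) => j ->; rewrite ?col_mxEu ?col_mxEd !mxE subr_le0;
  have [] := H j.
Qed.

Local Notation feasible := (on_stack d (Omega3 alpha)).

Lemma Omega3_normal_wb z h :
  frechet_normal feasible z h -> w_part h = 0 /\ b_part h = 0.
Proof.
move=> hn; have zO : feasible z by case: hn.
have ray w b : dot (w_part h) w + dot (b_part h) b <= 0.
  have := @frechet_normal_ray _ _ feasible z h (stack w b 0 0) 1 ltr01.
  rewrite dot_stack !dot0r !addr0 => H; apply: H hn => t _.
  by rewrite -[z]stack_parts stackZ stackD !scaler0 !addr0 on_stackE.
split; apply: dot_eq0; apply/eqP; rewrite eq_le dot_ge0 andbT.
  by have := ray (w_part h) 0; rewrite dot0r addr0.
by have := ray 0 (b_part h); rewrite dot0r add0r.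
Qed.

(** The two constraints on a coordinate have independent gradients, so that
    each can be moved while the other is kept: the direction [(1, 1)] relaxes
    the second one only, and [(- alpha, - 1)] the first one only. They give the
    signs of the multipliers, and the reverse directions, feasible when the
    constraint is slack, give complementarity. *)
Lemma Omega3_normal_vu z h i (hv := v_part h i 0) (hu := u_part h i 0) :
  frechet_normal feasible z h ->
  [/\ hv + hu <= 0, 0 <= hu + alpha * hv,
      (hv + hu) * (alpha * u_part z i 0 - v_part z i 0) = 0
    & (hu + alpha * hv) * (u_part z i 0 - v_part z i 0) = 0].
Proof.
move=> hn; have a1 := alpha_lt1; have a0 := alpha_gt0.
have zO : feasible z by case: hn.
have {}zO : forall j, u_part z j 0 <= v_part z j 0 /\
    alpha * u_part z j 0 <= v_part z j 0.
  exact/(Omega3P (w_part z) (b_part z)).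
have ray dv du r : 0 < r -> (forall t, 0 < t <= r ->
     u_part z i 0 + t * du <= v_part z i 0 + t * dv /\
     alpha * (u_part z i 0 + t * du) <= v_part z i 0 + t * dv) ->
   hv * dv + hu * du <= 0.
  move=> r0 H; have := @frechet_normal_ray _ _ feasible z h
    (stack 0 0 (dv *: delta_mx i 0) (du *: delta_mx i 0)) r r0.
  rewrite dot_stack !dot0r !add0r !dotZr !dot_delta -/hv -/hu.
  rewrite mulrC [du * _]mulrC => K; apply: K hn => t tr.
  rewrite -[z]stack_parts stackZ stackD on_stackE; apply/Omega3P => j.
  have DE (y : cvV) c : (y + t *: (c *: delta_mx i 0)) j 0
      = y j 0 + t * (c * (j == i)%:R) by rewrite !mxE eqxx andbT.
  rewrite !DE; case: eqVneq => [->|_]; first by rewrite !mulr1; exact: H.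
  by rewrite !mulr0 !addr0; exact: zO.
have [zu zau] := zO i; clearbody hv hu.
have r1 : hv + hu <= 0.
  rewrite -[hv]mulr1 -[hu]mulr1.
  by apply: (ray 1 1 1) => // t /andP[t0 _]; split; nra.
have r2 : hv * - alpha + hu * -1 <= 0.
  by apply: (ray (- alpha) (-1) 1) => // t /andP[t0 _]; split; nra.
move: (u_part z i 0) (v_part z i 0) zu zau ray => s t zu zau ray.
split => //; first by lra.
  have [->|ts] := eqVneq (alpha * s) t; first by rewrite subrr mulr0.
  have lt_st : 0 < t - alpha * s by rewrite subr_gt0 lt_neqAle ts.
  suff : hv * -1 + hu * -1 <= 0 => [H|].
    have -> : hv + hu = 0 by apply/eqP; rewrite eq_le; apply/andP; split; lra.
    by rewrite mul0r.
  apply: (ray (-1) (-1) (t - alpha * s)) => // r /andP[r0 rt]; split; nra.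
have [->|ts] := eqVneq s t; first by rewrite subrr mulr0.
have lt_st : 0 < t - s by rewrite subr_gt0 lt_neqAle ts.
suff : hv * alpha + hu * 1 <= 0 => [H|].
  have -> : hu + alpha * hv = 0.
    by apply/eqP; rewrite eq_le; apply/andP; split; lra.
  by rewrite mul0r.
by apply: (ray alpha 1 (t - s)) => // r /andP[r0 rt]; split; nra.
Qed.

(** ** Subgradients of the augmented Lagrangian *)

Context (X : 'M[R]_(d 0%N, N)) (Y : 'M[R]_(d L.+1, N)) (lw lv : R).

Local Notation lagrangian rho xi :=
  (on_stack d (aug_lag X Y alpha lw lv beta rho xi)).

Section Blocks.
Context (rho : R) (xi : cvV) (z g : cvZ).
Let w := w_part z.
Let b := b_part z.
Let v := v_part z.
Let u := u_part z.
Let m := xi + rho *: residual X w b v u.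
Context (zg : frechet_subdiff (lagrangian rho xi) z g).

Local Notation penalty w b v u :=
  (dot xi (residual X w b v u) + rho / 2 * enorm (residual X w b v u) ^+ 2).

Let vB (p q a c : cvV) : (a - p - c) - (a - q - c) = - (p - q).
Proof. by apply/colP => i; rewrite !mxE; ring. Qed.

(** In each block the penalized coupling acts like the constraint with the
    shifted multiplier [m]. In [b] and [v] the Lagrangian is smooth and its
    subgradient is the gradient; in [w] and [u] one nonsmooth term is left. *)
Lemma lagrangian_subdiff_w :
  frechet_subdiff (reg1 lw) w (w_part g + (Psi X v)^T *m m).
Proof.
pose q y := obj_bar Y lw lv w v - reg1 lw w
  + dot (beta_vec beta) (v - sigma alpha u) + penalty y b v u.
have -> : w_part g + (Psi X v)^T *m m = w_part g - (0 + (- Psi X v)^T *m m).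
  by rewrite add0r linearN mulNmx opprK.
apply: (@frechet_subdiffD _ _ _ q); last first.
  apply: linearizesD; first exact: linearizes_cst.
  by apply: linearizes_penalty => y; rewrite vB mulNmx mulmxBr.
have -> : (fun y => reg1 lw y + q y)
    = fun y => lagrangian rho xi (stack y b v u).
  by apply/funext => y; rewrite on_stackE /q /aug_lag /obj /obj_bar; ring.
apply: (@frechet_subdiff_comp _ _ _ _ (fun y => stack y b v u) _ g).
- by move=> y; rewrite stackN stackD !subrr enorm_stack !dot0l !addr0.
- by move=> y; rewrite stackN stackD !subrr dot_stack !dot0r !addr0.
- by rewrite stack_parts.
Qed.

Lemma lagrangian_subdiff_b : b_part g = - (Amx^T *m m).
Proof.
have fg : frechet_subdiff (fun y => lagrangian rho xi (stack w y v u)) b (b_part g).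
  apply: (@frechet_subdiff_comp _ _ _ _ (fun y => stack w y v u) _ g).
  - by move=> y; rewrite stackN stackD !subrr enorm_stack !dot0l !addr0 add0r.
  - by move=> y; rewrite stackN stackD !subrr dot_stack !dot0r !addr0 add0r.
  - by rewrite stack_parts.
apply: (frechet_subdiff_linearizes fg).
apply: (@eq_linearizes _ _ (fun y => obj Y alpha lw lv beta w v u + penalty w y v u)
  _ _ (0 + (- Amx)^T *m m)).
- by move=> y; rewrite on_stackE /aug_lag addrA.
- by rewrite add0r linearN mulNmx.
apply: linearizesD; first exact: linearizes_cst.
apply: linearizes_penalty => y; rewrite /residual mulNmx mulmxBr.
move: (Psi X v *m w) (Amx *m y) (Amx *m b) => p a a'.
by apply/colP => i; rewrite !mxE; ring.
Qed.

Lemma lagrangian_subdiff_v :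
  v_part g = obj_bar_grad Y lv v + beta_vec beta - (Psi_deriv w)^T *m m.
Proof.
have fg : frechet_subdiff (fun y => lagrangian rho xi (stack w b y u)) v (v_part g).
  apply: (@frechet_subdiff_comp _ _ _ _ (fun y => stack w b y u) _ g).
  - by move=> y; rewrite stackN stackD !subrr enorm_stack !dot0l !addr0 !add0r.
  - by move=> y; rewrite stackN stackD !subrr dot_stack !dot0r !addr0 !add0r.
  - by rewrite stack_parts.
apply: (frechet_subdiff_linearizes fg).
apply: (@eq_linearizes _ _ (fun y => obj_bar Y lw lv w y
  + dot (beta_vec beta) (y - sigma alpha u) + penalty w b y u)
  _ _ (obj_bar_grad Y lv v + beta_vec beta + (- Psi_deriv w)^T *m m)).
- by move=> y; rewrite on_stackE /aug_lag addrA.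
- by rewrite linearN mulNmx.
apply: linearizesD; first apply: linearizesD.
- exact: obj_bar_linearizes.
- by apply: linearizes_affine => y; rewrite -dotBr opprB addrA subrK.
- by apply: linearizes_penalty => y; rewrite vB Psi_mulmxB mulNmx.
Qed.

Lemma lagrangian_subdiff_u :
  frechet_subdiff activation_gain u (u_part g - m).
Proof.
pose q y := obj_bar Y lw lv w v + dot (beta_vec beta) v + penalty w b v y.
have -> : u_part g - m = u_part g - (0 + 1%:M^T *m m).
  by rewrite add0r trmx1 mul1mx.
apply: (@frechet_subdiffD _ _ _ q); last first.
  apply: linearizesD; first exact: linearizes_cst.
  apply: linearizes_penalty => y; rewrite mul1mx /residual.
  by move: (Psi X v *m w) (Amx *m b) => p a; apply/colP => i; rewrite !mxE; ring.
have -> : (fun y => - dot (beta_vec beta) (sigma alpha y) + q y)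
    = fun y => lagrangian rho xi (stack w b v y).
  by apply/funext => y; rewrite on_stackE /q /aug_lag /obj dotBr; ring.
apply: (@frechet_subdiff_comp _ _ _ _ (fun y => stack w b v y) _ g).
- by move=> y; rewrite stackN stackD !subrr enorm_stack !dot0l !addr0 !add0r.
- by move=> y; rewrite stackN stackD !subrr dot_stack !dot0r !addr0 !add0r.
- by rewrite stack_parts.
Qed.

End Blocks.

End Stationarity.

(** * Limits of almost stationary points are KKT points *)

Section Closure.
Context {R : realType} {L N : nat} {d : nat -> nat}.
Local Notation cvW := 'cV[R]_(dim_w L d).
Local Notation cvB := 'cV[R]_(dim_b L d).
Local Notation cvV := 'cV[R]_(dim_v L N d).
Local Notation cvZ := 'cV[R]_(dim_z L N d).
Local Notation Psi := (@Defs.Psi R L N d).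
Local Notation Amx := (@Defs.Amx R L N d).
Local Notation Psi_deriv := (@Psi_deriv R L N d).
Local Notation stack := (@Defs.stack R L N d).
Context (X : 'M[R]_(d 0%N, N)) (Y : 'M[R]_(d L.+1, N)) (alpha lw lv : R).
Context (beta : 'I_L.+1 -> R).
Context (halpha : 0 < alpha < 1) (hbeta : forall l, 0 < beta l).

Local Notation lagrangian rho xi :=
  (on_stack d (aug_lag X Y alpha lw lv beta rho xi)).
Local Notation feasible := (on_stack d (Omega3 alpha)).
Local Notation activation_gain :=
  (fun u' : cvV => - dot (beta_vec beta) (sigma alpha u')).

Lemma grad_cstr_v (mu1 mu2 u v : cvV) :
  grad (fun v' => dot (col_mx mu1 mu2) (cstr alpha v' u)) v = - (mu1 + mu2).
Proof.
apply: grad_linearizes; apply: linearizes_affine => y.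
by rewrite !dot_col_mx !(dotBr, dotNl, dotDl); ring.
Qed.

Lemma grad_cstr_u (mu1 mu2 u v : cvV) :
  grad (fun u' => dot (col_mx mu1 mu2) (cstr alpha v u')) u
  = mu1 + alpha *: mu2.
Proof.
apply: grad_linearizes; apply: linearizes_affine => y.
by rewrite !dot_col_mx !(dotBr, dotZr, dotZl, dotDl); ring.
Qed.

Lemma grad_Psi w (xi v : cvV) :
  grad (fun v' => dot xi (Psi X v' *m w)) v = (Psi_deriv w)^T *m xi.
Proof.
apply: grad_linearizes; apply: linearizes_affine => y.
by rewrite -dotBr Psi_mulmxB dot_mulmx.
Qed.

Section Sequences.
Context (z1 z2 gs hs : nat -> cvZ) (rho : nat -> R) (xi : nat -> cvV).
Context (zstar : cvZ).
Context (z1_cvg : z1 @ \oo --> zstar) (z2_cvg : z2 @ \oo --> zstar).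
Context (gs_subdiff :
  forall k, frechet_subdiff (lagrangian (rho k) (xi k)) (z1 k) (gs k)).
Context (hs_normal : forall k, frechet_normal feasible (z2 k) (hs k)).
Context (sum_cvg : (fun k => gs k + hs k) @ \oo --> (0 : cvZ)).
Context (zstar_residual :
  residual X (w_part zstar) (b_part zstar) (v_part zstar) (u_part zstar) = 0).

(** The multiplier of the KKT conditions will be a limit of these. They are
    taken at [z1], where the Frechet subgradients live, rather than at the
    iterates, so that no closeness of multipliers has to be arranged. *)
Let m k := xi k + rho k *:
  residual X (w_part (z1 k)) (b_part (z1 k)) (v_part (z1 k)) (u_part (z1 k)).
Let r k := gs k + hs k.
Let hv k := v_part (hs k).
Let hu k := u_part (hs k).

Let r_cvg : [/\ (fun k => w_part (r k)) @ \oo --> (0 : cvW),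
  (fun k => b_part (r k)) @ \oo --> (0 : cvB),
  (fun k => v_part (r k)) @ \oo --> (0 : cvV)
  & (fun k => u_part (r k)) @ \oo --> (0 : cvV)].
Proof.
have p0 : [/\ w_part (0 : cvZ) = 0, b_part (0 : cvZ) = 0,
    v_part (0 : cvZ) = 0 & u_part (0 : cvZ) = 0].
  by rewrite /w_part /b_part /v_part /u_part !linear0.
by case: p0 (cvg_parts sum_cvg) => -> -> -> ->.
Qed.

Let hvE k : hv k = v_part (r k)
  - (obj_bar_grad Y lv (v_part (z1 k)) + beta_vec beta
     - (Psi_deriv (w_part (z1 k)))^T *m m k).
Proof.
by rewrite -(lagrangian_subdiff_v (gs_subdiff k)) v_partD addrAC subrr add0r.
Qed.

Let mE k : exists2 s, frechet_subdiff activation_gain (u_part (z1 k)) s &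
  m k = u_part (r k) - hu k - s.
Proof.
exists (u_part (gs k) - m k); first exact: lagrangian_subdiff_u.
by rewrite u_partD addrK opprB addrCA subrr addr0.
Qed.

(** The two sign conditions on a normal confine [(hv, hu)] to a cone in which
    [hv] dominates. *)
Let hu_le k i : `|hu k i 0| <= `|hv k i 0|.
Proof.
have [+ + _ _] := Omega3_normal_vu halpha i (hs_normal k).
rewrite -/(hu k) -/(hv k); case/andP: halpha => a0 a1.
move: (hu k i 0) (hv k i 0) => a c H1 H2.
have c0 : c <= 0 by nra.
have a_ge0 : 0 <= a by nra.
by rewrite ger0_norm // ler0_norm //; lra.
Qed.

(** The equation for [u] expresses the multiplier by the [u] part of the normal
    and a subgradient of the activation term, which is bounded by [beta]. *)
Let bounded_m_of_hv i : bounded_seq (fun k => hv k i 0) ->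
  bounded_seq (fun k => m k i 0).
Proof.
move=> hvb; have [_ _ _ /cvg_coordP/(_ i)/cvg_bounded_seq rb] := r_cvg.
apply: (@bounded_seq_le _ _
  (fun k => `|u_part (r k) i 0| + `|hv k i 0| + beta (layer_of i))).
  move=> k; have [s /(activation_subgradient_le halpha hbeta i) s_le ->] := mE k.
  have -> : (u_part (r k) - hu k - s) i 0
      = u_part (r k) i 0 - hu k i 0 - s i 0 by rewrite !mxE.
  apply: (le_trans (ler_normB _ _)); apply: lerD => //.
  by apply: (le_trans (ler_normB _ _)); rewrite lerD2l.
apply: bounded_seqD; last exact: bounded_seq_cst.
by apply: bounded_seqD; exact: bounded_seq_norm.
Qed.

(** Backward induction on the layers: the equation for [v] at a layer bounds
    the normal there, hence the multiplier, in terms of the multipliers of the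
    next layer. *)
Let bounded_hv i : bounded_seq (fun k => hv k i 0).
Proof.
have [_ _ /cvg_coordP/(_ _)/cvg_bounded_seq rb _] := r_cvg.
have [w1_cvg _ v1_cvg _] := cvg_parts z1_cvg.
suff H n j : (L.+1 <= layer_of j + n)%N -> bounded_seq (fun k => hv k j 0).
  by apply: (H L.+1); rewrite leq_addl.
elim: n j => [|n IHn] j; first by rewrite addn0 leqNgt ltn_ord.
move=> jn; pose T k := ((Psi_deriv (w_part (z1 k)))^T *m m k) j 0.
have Tb : bounded_seq T.
  rewrite (_ : T = fun k =>
    \sum_i Psi_deriv (w_part (z1 k)) i j * m k i 0); last first.
    by apply/funext => k; rewrite /T mxE; apply: eq_bigr => l _; rewrite mxE.
  apply: (@bounded_seq_sum _ _
    (fun i k => Psi_deriv (w_part (z1 k)) i j * m k i 0)) => l.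
  have [lj|lj] := eqVneq (layer_of l : nat) (layer_of j).+1.
    apply: bounded_seqM.
      by apply: cvg_bounded_seq; exact: (cvg_Psi_deriv w1_cvg).
    by apply: bounded_m_of_hv; apply: IHn; rewrite lj addSnnS.
  rewrite (_ : (fun k => _) = fun=> 0); first exact: bounded_seq_cst.
  apply/funext => k; apply/eqP; rewrite mulf_eq0; apply/orP; left.
  by apply: contra_neqT lj; exact: Psi_deriv_next.
rewrite (_ : (fun k => _) = fun k => v_part (r k) j 0 -
    (obj_bar_grad Y lv (v_part (z1 k)) j 0 + (beta_vec beta : cvV) j 0 - T k)).
  apply: bounded_seqD; first exact: rb.
  apply: bounded_seqN; apply: bounded_seqD; last exact: bounded_seqN.
  apply: bounded_seqD; last exact: bounded_seq_cst.
  have /cvg_coordP /(_ j) := @cvg_obj_bar_grad R L N d Y lv _ _ v1_cvg.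
  exact: cvg_bounded_seq.
by apply/funext => k; rewrite hvE !(coordB, coordD).
Qed.

(** The multipliers and the normals being bounded, a subsequence of them
    converges, and every relation between them is closed. The relations for
    [w] and [u] are memberships in a Frechet subdifferential, whose limits are
    limiting subgradients by definition. *)
Lemma stationary_limit_KKT :
  on_stack d (KKT_point X Y alpha lw lv beta) zstar.
Proof.
case/andP: halpha => a0 a1.
have [phi phioo [l]] : exists2 phi : nat -> nat, phi @ \oo --> \oo &
    exists l : 'cV[R]_(dim_v L N d + dim_v L N d),
    (fun k => col_mx (m (phi k)) (hu (phi k))) @ \oo --> l.
  apply: (bounded_vec_subcvg (xs := fun k => col_mx (m k) (hu k))) => i.
  case: (split_ordP i) => j ->; under eq_fun do rewrite ?col_mxEu ?col_mxEd.
    exact: bounded_m_of_hv.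
  apply: bounded_seq_le (bounded_seq_norm (bounded_hv j)) => k.
  exact: hu_le.
rewrite -[l]vsubmxK => /cvg_col_mx [].
move: (usubmx l) (dsubmx l) => ms hus m_cvg hu_cvg {l}.
have along n (f : nat -> 'cV[R]_n) (x : 'cV[R]_n) :
    f @ \oo --> x -> (fun k => f (phi k)) @ \oo --> x.
  by move=> fx; exact: cvg_comp phioo fx.
have [/along rw /along rb /along rv /along ru] := r_cvg.
have [/[dup] /along w1 w1_ /along b1 /along v1 /along u1] := cvg_parts z1_cvg.
have [_ _ /along v2 /along u2] := cvg_parts z2_cvg.
set w := w_part zstar in w1 *; set b := b_part zstar in b1 *.
set v := v_part zstar in v1 v2 *; set u := u_part zstar in u1 u2 *.
pose hvs : cvV := - (obj_bar_grad Y lv v + beta_vec beta - (Psi_deriv w)^T *m ms).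
have hv_cvg : (fun k => hv (phi k)) @ \oo --> hvs.
  rewrite /hvs -[X in _ --> X]add0r; under eq_cvg do rewrite hvE.
  apply: cvgB => //; apply: cvgB.
    by apply: cvgD; [exact: cvg_obj_bar_grad|exact: cvg_cst].
  apply: cvg_mulmx => // i j; rewrite mxE; under eq_cvg do rewrite mxE.
  exact: cvg_Psi_deriv.
have coord n (f : nat -> 'cV[R]_n) (x : 'cV[R]_n) i :
    f @ \oo --> x -> (fun k => f k i 0) @ \oo --> x i 0.
  by move=> /cvg_coordP.
have normal i : [/\ hvs i 0 + hus i 0 <= 0, 0 <= hus i 0 + alpha * hvs i 0,
    (hvs i 0 + hus i 0) * (alpha * u i 0 - v i 0) = 0
  & (hus i 0 + alpha * hvs i 0) * (u i 0 - v i 0) = 0].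
  have hvi := coord _ _ _ i hv_cvg; have hui := coord _ _ _ i hu_cvg.
  have u2i := coord _ _ _ i u2; have v2i := coord _ _ _ i v2.
  have c1 : (fun k => hv (phi k) i 0 + hu (phi k) i 0) @ \oo
    --> hvs i 0 + hus i 0 by exact: cvgD.
  have c2 : (fun k => hu (phi k) i 0 + alpha * hv (phi k) i 0) @ \oo
    --> hus i 0 + alpha * hvs i 0.
    by apply: cvgD => //; apply: cvgM => //; exact: cvg_cst.
  have c3 : (fun k => alpha * u_part (z2 (phi k)) i 0
      - v_part (z2 (phi k)) i 0) @ \oo --> alpha * u i 0 - v i 0.
    by apply: cvgB => //; apply: cvgM => //; exact: cvg_cst.
  have c4 : (fun k => u_part (z2 (phi k)) i 0
    - v_part (z2 (phi k)) i 0) @ \oo --> u i 0 - v i 0 by exact: cvgB.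
  have hn k := Omega3_normal_vu halpha i (hs_normal (phi k)).
  split.
  - by apply: (limit_le c1 (cvg_cst 0)) => k; case: (hn k).
  - by apply: (limit_le (cvg_cst 0) c2) => k; case: (hn k).
  - by apply: (limit_eq (cvgM c1 c3) (cvg_cst 0)) => k; case: (hn k).
  - by apply: (limit_eq (cvgM c2 c4) (cvg_cst 0)) => k; case: (hn k).
have c1 : (1 - alpha)^-1 >= 0 by rewrite invr_ge0 subr_ge0 ltW.
have cne : 1 - alpha != 0 by rewrite subr_eq0 gt_eqF.
(* the multipliers solve mu1 + mu2 = - hvs and mu1 + alpha mu2 = hus *)
pose mu1 : cvV := (1 - alpha)^-1 *: (hus + alpha *: hvs).
pose mu2 : cvV := - ((1 - alpha)^-1 *: (hvs + hus)).
have mu1E i : mu1 i 0 = (1 - alpha)^-1 * (hus i 0 + alpha * hvs i 0).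
  by rewrite coordZ coordD coordZ.
have mu2E i : mu2 i 0 = (1 - alpha)^-1 * - (hvs i 0 + hus i 0).
  by rewrite coordN coordZ coordD mulrN.
have mu12 : - (mu1 + mu2) = hvs.
  by apply/colP => i; rewrite [LHS]coordN (coordD mu1 mu2) mu1E mu2E; field.
have mu1a2 : mu1 + alpha *: mu2 = hus.
  by apply/colP => i; rewrite (coordD mu1) (coordZ alpha mu2) mu1E mu2E; field.
exists (col_mx mu1 mu2), ms; split.
- move=> i; case: (split_ordP i) => j ->; rewrite ?col_mxEu ?col_mxEd.
    by rewrite mu1E mulr_ge0 //; case: (normal j).
  by rewrite mu2E mulr_ge0 // oppr_ge0; case: (normal j).
- split.
    exists ((Psi X v)^T *m ms); last by rewrite subrr.
    exists (fun k => w_part (z1 (phi k))),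
      (fun k => w_part (gs (phi k))
         + (Psi X (v_part (z1 (phi k))))^T *m m (phi k)); split.
    + exact: w1.
    + exact: cvg_reg1.
    + by move=> k; exact: lagrangian_subdiff_w.
    + rewrite -[X in _ --> X]add0r; apply: cvgD.
        have wE k : w_part (gs (phi k)) = w_part (r (phi k)).
          by rewrite w_partD (Omega3_normal_wb (hs_normal _)).1 addr0.
        by under eq_cvg do rewrite wE.
      apply: cvg_mulmx => // i j; rewrite mxE; under eq_cvg do rewrite mxE.
      exact: cvg_Psi.
  have bE k : - (Amx^T *m m (phi k)) = b_part (r (phi k)).
    rewrite b_partD (Omega3_normal_wb (hs_normal _)).2 addr0.
    by rewrite (lagrangian_subdiff_b (gs_subdiff _)).
  have : (fun k => - (Amx^T *m m (phi k))) @ \oo --> - (Amx^T *m ms).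
    by apply: cvgN; apply: cvg_mulmx => // i j; exact: cvg_cst.
  under eq_cvg do rewrite bE; move=> /(cvg_unique _ rb) E.
  by apply: oppr_inj; rewrite oppr0; apply: E; exact: norm_hausdorff.
- rewrite grad_cstr_v mu12 grad_Psi (grad_linearizes (obj_bar_linearizes _ _ _ _ _)).
  by rewrite addrAC /hvs subrr.
- rewrite grad_cstr_u mu1a2.
  exists (- hus - ms); last by rewrite -addrA addrACA addNr addNr addr0.
  exists (fun k => u_part (z1 (phi k))),
    (fun k => u_part (gs (phi k)) - m (phi k)); split.
  + exact: u1.
  + exact: cvg_activation_gain.
  + by move=> k; exact: lagrangian_subdiff_u.
  + apply: cvgB => //.
    have uE k : u_part (gs (phi k)) = u_part (r (phi k)) - hu (phi k).
      by rewrite u_partD addrK.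
    by rewrite -[- hus]add0r; under eq_cvg do rewrite uE; exact: cvgB.
- split.
  + apply/(Omega3P alpha w b) => i.
    have f2 k : u_part (z2 (phi k)) i 0 <= v_part (z2 (phi k)) i 0 /\
        alpha * u_part (z2 (phi k)) i 0 <= v_part (z2 (phi k)) i 0.
      move: i; apply/(Omega3P alpha (w_part (z2 (phi k))) (b_part (z2 (phi k)))).
      by case: (hs_normal (phi k)).
    split.
      apply: (limit_le (coord _ _ _ i u2) (coord _ _ _ i v2)) => k.
      by case: (f2 k).
    apply: (limit_le (cvgM (cvg_cst alpha) (coord _ _ _ i u2))
      (coord _ _ _ i v2)) => k.
    by case: (f2 k).
  + rewrite dot_col_mx /dot !big1 ?addr0 // => i _.
      rewrite coordB coordZ mu2E -mulrA mulNr; case: (normal i) => _ _ -> _.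
      by rewrite oppr0 mulr0.
    by rewrite coordB mu1E -mulrA; case: (normal i) => _ _ _ ->; rewrite mulr0.
  + exact: zstar_residual.
Qed.

End Sequences.

(** Limiting subgradients and normals are first replaced by Frechet ones at
    points that are closer and closer to the sequence. *)
Lemma almost_stationary_limit_KKT (zs : nat -> cvZ) zstar
    (rho eps : nat -> R) (xi : nat -> cvV) :
  zs @ \oo --> zstar -> eps @ \oo --> (0 : R) ->
  (forall k, (dist_to 0 ([set g + h
      | g in limiting_subdiff (lagrangian (rho k) (xi k)) (zs k)
      & h in limiting_normal feasible (zs k)])%R <= (eps k)%:E)%E) ->
  residual X (w_part zstar) (b_part zstar) (v_part zstar) (u_part zstar) = 0 ->
  on_stack d (KKT_point X Y alpha lw lv beta) zstar.
Proof.
move=> zz eps0 zdist res0.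
have /choice [f fP] : forall k, exists p : (cvZ * cvZ) * (cvZ * cvZ),
    [/\ enorm (p.1.1 - zs k) <= k.+1%:R^-1, enorm (p.1.2 - zs k) <= k.+1%:R^-1,
        frechet_subdiff (lagrangian (rho k) (xi k)) p.1.1 p.2.1,
        frechet_normal feasible p.1.2 p.2.2
      & enorm (p.2.1 + p.2.2) <= eps k + 3 * k.+1%:R^-1].
  move=> k; have e0 : 0 < k.+1%:R^-1 :> R by rewrite invr_gt0.
  have [_ [g gsub [h hn <-]]] := dist_to_attained (zdist k) e0.
  rewrite sub0r enormN => ghe.
  have [z1 [g1 [gsub1 z1e g1e]]] := limiting_subdiff_near gsub e0.
  have [z2 [h2 [hn2 z2e h2e]]] := limiting_normal_near hn e0.
  exists ((z1, z2), (g1, h2)); split=> //=; [exact: ltW|exact: ltW|].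
  have -> : g1 + h2 = (g + h) + ((g1 - g) + (h2 - h)).
    by rewrite addrACA [g + _]addrC [h + _]addrC !subrK.
  apply: (le_trans (ler_enormD _ _)).
  have := ler_enormD (g1 - g) (h2 - h).
  move: g1e h2e ghe; move: (k.+1%:R^-1) => e ? ? ? ?; lra.
have inv0 : (fun k => k.+1%:R^-1 : R) @ \oo --> (0 : R) by exact: cvg_harmonic.
apply: (@stationary_limit_KKT (fun k => (f k).1.1) (fun k => (f k).1.2)
  (fun k => (f k).2.1) (fun k => (f k).2.2) rho xi) => //.
- by apply: (cvg_near zz inv0) => k; case: (fP k).
- by apply: (cvg_near zz inv0) => k; case: (fP k).
- by move=> k; case: (fP k).
- by move=> k; case: (fP k).
- apply: (@cvg_near _ _ (fun=> 0) _ _ (fun k => eps k + 3 * k.+1%:R^-1)).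
  + exact: cvg_cst.
  + rewrite -[X in _ --> X]addr0; apply: cvgD => //.
    rewrite -[X in _ --> X](mulr0 3); apply: cvgM => //; exact: cvg_cst.
  + by move=> k; rewrite subr0; case: (fP k).
Qed.

End Closure.

(** * Bounds from the descent condition *)

Section Objective.
Context {R : realType} {L N : nat} {d : nat -> nat}.
Local Notation cvW := 'cV[R]_(dim_w L d).
Local Notation cvB := 'cV[R]_(dim_b L d).
Local Notation cvV := 'cV[R]_(dim_v L N d).
Local Notation cvZ := 'cV[R]_(dim_z L N d).
Local Notation Psi := (@Defs.Psi R L N d).
Local Notation Amx := (@Defs.Amx R L N d).
Local Notation stack := (@Defs.stack R L N d).
Context (hN : (0 < N)%N).
Context (X : 'M[R]_(d 0%N, N)) (Y : 'M[R]_(d L.+1, N)) (alpha lw lv : R).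
Context (beta : 'I_L.+1 -> R).
Context (halpha : 0 < alpha < 1) (hlw : 0 < lw) (hlv : 0 < lv).
Context (hbeta : forall l, 0 < beta l).
Local Notation obj := (obj Y alpha lw lv beta).

(** Feasibility says [sigma u <= v], so all terms of the objective are
    nonnegative and each is bounded by the whole. *)
Lemma gap_ge0 w b (v u : cvV) i : Omega3 alpha w b v u ->
  0 <= beta (layer_of i) * (v i 0 - sigma alpha u i 0).
Proof.
move=> /Omega3P /(_ i) [uv auv]; apply: mulr_ge0; first exact: ltW.
by rewrite subr_ge0 sigmaE ge_max uv.
Qed.

Lemma gapE (v u : cvV) : dot (beta_vec beta) (v - sigma alpha u)
  = \sum_i beta (layer_of i) * (v i 0 - sigma alpha u i 0).
Proof. by apply: eq_bigr => i _; rewrite beta_vecE coordB. Qed.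

Lemma fit_ge0 (v : cvV) :
  0 <= N%:R^-1 * \sum_(n < N) enorm (col n (layer v ord_max) - col n Y) ^+ 2.
Proof. by rewrite mulr_ge0 ?invr_ge0 // sumr_ge0 // => n _; exact: sqr_ge0. Qed.

Lemma reg2_ge0 (v : cvV) : 0 <= reg2 lv v.
Proof. by apply: mulr_ge0; [exact: ltW|exact: sqr_ge0]. Qed.

Lemma gap_sum_ge0 w b (v u : cvV) : Omega3 alpha w b v u ->
  0 <= dot (beta_vec beta) (v - sigma alpha u).
Proof. by move=> H; rewrite gapE sumr_ge0 // => i _; exact: gap_ge0 H. Qed.

Lemma obj_ge0 w b v u : Omega3 alpha w b v u -> 0 <= obj w v u.
Proof.
move=> /gap_sum_ge0 g0; apply: addr_ge0 => //; apply: addr_ge0.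
  by apply: addr_ge0; [exact: fit_ge0|exact: reg1_ge0].
exact: reg2_ge0.
Qed.

Lemma reg1_le_obj w b v u : Omega3 alpha w b v u -> reg1 lw w <= obj w v u.
Proof.
move=> /gap_sum_ge0; have := fit_ge0 v; have := reg2_ge0 v.
by rewrite /Defs.obj /obj_bar; lra.
Qed.

Lemma reg2_le_obj w b v u : Omega3 alpha w b v u -> reg2 lv v <= obj w v u.
Proof.
move=> /gap_sum_ge0; have := fit_ge0 v; have := reg1_ge0 w hlw.
by rewrite /Defs.obj /obj_bar; lra.
Qed.

Lemma gap_le_obj w b v u i : Omega3 alpha w b v u ->
  beta (layer_of i) * (v i 0 - sigma alpha u i 0) <= obj w v u.
Proof.
move=> H; apply: (@le_trans _ _ (dot (beta_vec beta) (v - sigma alpha u))).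
  rewrite gapE (bigD1 i) //= lerDl sumr_ge0 // => j _; exact: gap_ge0 H.
have := fit_ge0 v; have := reg1_ge0 w hlw; have := reg2_ge0 v.
by rewrite /Defs.obj /obj_bar; lra.
Qed.

(** The penalty on the gap between [v] and [sigma u] is what bounds [u]. *)
Lemma obj_coercive w b v u M : Omega3 alpha w b v u -> obj w v u <= M ->
  [/\ forall i, `|w i 0| <= M / lw, forall i, `|v i 0| <= M / lv + 1
    & forall i, `|u i 0| <= (M / lv + 1 + M / beta (layer_of i)) / alpha].
Proof.
move=> H oM; case/andP: halpha => a0 a1.
have vb i : `|v i 0| <= M / lv + 1.
  have : lv * `|v i 0| ^+ 2 <= M.
    apply: le_trans oM; apply: le_trans (reg2_le_obj H).
    rewrite /reg2 ler_pM2l // ler_sqr ?nnegrE ?enorm_ge0 //.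
    exact: coord_le_enorm.
  rewrite mulrC -ler_pdivlMr //; move: (M / lv) (normr_ge0 (v i 0)) => q.
  by move: `|v i 0| => s; nra.
split=> // i.
  rewrite ler_pdivlMr // mulrC; apply: le_trans oM.
  exact: le_trans (reg1_coord_le _ _ hlw) (reg1_le_obj H).
have g1 : v i 0 - sigma alpha u i 0 <= M / beta (layer_of i).
  by rewrite ler_pdivlMr // mulrC (le_trans (gap_le_obj i H)).
have g2 := gap_ge0 i H; rewrite pmulr_rge0 // in g2.
have := vb i; rewrite ler_norml ler_pdivlMr // => /andP[].
move: g1 g2; rewrite sigmaE.
move: (M / lv) (M / beta _) (u i 0) (v i 0) => q1 q2 s t.
by case: (ger0P s) => s0; case: (leP s (alpha * s)) => ? ? ? ? ?; nra.
Qed.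

(** Completing the square in [dot xi c + rho / 2 * enorm c ^+ 2], for the residual
    [c]: the multiplier can lower the Lagrangian by at most
    [enorm xi ^+ 2 / (2 * rho)]. *)
Lemma aug_lag_bounds theta rho (xi : cvV) w b v u :
  0 <= theta -> 0 < rho -> Omega3 alpha w b v u ->
  aug_lag X Y alpha lw lv beta rho xi w b v u < theta ->
  obj w v u <= theta + enorm xi ^+ 2 / rho /\
  enorm (residual X w b v u) ^+ 2 <= 4 * theta / rho + 4 * (enorm xi / rho) ^+ 2.
Proof.
move=> t0 r0 H; rewrite /aug_lag; have := obj_ge0 H.
have := cauchy_schwarz xi (residual X w b v u); rewrite ler_norml => /andP[+ _].
move: (dot _ _) (enorm (residual _ _ _ _ _)) (enorm_ge0 xi) (obj w v u).
move=> p c x0 o; move: (enorm xi) x0 => x x0 hp o0 hL.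
have sq : 0 <= (rho * c - 2 * x) ^+ 2 by exact: sqr_ge0.
have sq' : 0 <= (rho * c - x) ^+ 2 by exact: sqr_ge0.
have rx : rho * (x ^+ 2 / rho) = x ^+ 2 by field; rewrite gt_eqF.
have H1 : rho * o <= rho * theta + x ^+ 2.
  have : rho * (o + p + rho / 2 * c ^+ 2) <= rho * theta by rewrite ler_pM2l // ltW.
  have : rho * - (x * c) <= rho * p by rewrite ler_pM2l.
  nra.
split.
  by rewrite -(ler_pM2l r0) mulrDr rx.
have r2 : 0 < rho ^+ 2 by rewrite exprn_gt0.
rewrite -(ler_pM2l r2).
have -> : rho ^+ 2 * (4 * theta / rho + 4 * (x / rho) ^+ 2)
    = 4 * rho * theta + 4 * x ^+ 2 by field; rewrite gt_eqF.
have : rho * (o + p + rho / 2 * c ^+ 2) <= rho * theta by rewrite ler_pM2l // ltW.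
have : rho * - (x * c) <= rho * p by rewrite ler_pM2l.
have : 0 <= rho * o by rewrite mulr_ge0 // ltW.
nra.
Qed.

(** Coercivity takes care of [w], [v] and [u], but the objective does not see the
    biases [b]: they are recovered from the residual, which converges. *)
Lemma bounded_obj_subcvg (w : nat -> cvW) (b : nat -> cvB) (v u : nat -> cvV) M :
  (forall k, Omega3 alpha (w k) (b k) (v k) (u k)) ->
  (forall k, obj (w k) (v k) (u k) <= M) ->
  (fun k => residual X (w k) (b k) (v k) (u k)) @ \oo --> (0 : cvV) ->
  exists2 phi : nat -> nat, phi @ \oo --> \oo & exists ws bs vs us,
    (fun k => stack (w (phi k)) (b (phi k)) (v (phi k)) (u (phi k))) @ \oo
      --> stack ws bs vs us
    /\ residual X ws bs vs us = 0.
Proof.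
move=> feas oM res0.
have [i|phi phioo [l]] := @bounded_vec_subcvg R _
  (fun k => col_mx (w k) (col_mx (v k) (u k))).
  case: (split_ordP i) => j ->.
    under eq_fun do rewrite col_mxEu; exists (M / lw) => k.
    by have [] := obj_coercive (feas k) (oM k).
  under eq_fun do rewrite col_mxEd; case: (split_ordP j) => j' ->.
    under eq_fun do rewrite col_mxEu; exists (M / lv + 1) => k.
    by have [] := obj_coercive (feas k) (oM k).
  under eq_fun do rewrite col_mxEd.
  exists ((M / lv + 1 + M / beta (layer_of j')) / alpha) => k.
  by have [] := obj_coercive (feas k) (oM k).
rewrite -[l]vsubmxK -[dsubmx l]vsubmxK => /cvg_col_mx[wl /cvg_col_mx[vl ul]].
move: (usubmx l) (usubmx (dsubmx l)) (dsubmx (dsubmx l)) wl vl ul.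
move=> ws vs us wl vl ul.
exists phi => //.
have resl : (fun k => residual X (w (phi k)) (b (phi k)) (v (phi k)) (u (phi k)))
  @ \oo --> (0 : cvV) by exact: cvg_comp phioo res0.
have AbE k : Amx *m b k = u k - Psi X (v k) *m w k
    - residual X (w k) (b k) (v k) (u k).
  by rewrite /residual opprB addrCA subrr addr0.
have Al : (fun k => Amx *m b (phi k)) @ \oo --> us - Psi X vs *m ws - 0.
  under eq_cvg do rewrite AbE; apply: cvgB => //; apply: cvgB => //.
  by apply: cvg_mulmx => //; exact: cvg_Psi.
have /choice [f fA] := fun k => @Amx_left_inverse R L N d hN k.
pose bs : cvB := \col_k (us - Psi X vs *m ws - 0) (f k) 0.
have bl : (fun k => b (phi k)) @ \oo --> bs.
  apply/cvg_coordP => i; rewrite mxE; under eq_cvg do rewrite -fA.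
  by move/cvg_coordP : Al; apply.
exists ws, bs, vs, us; split; first by apply/cvg_stack.
have := @cvg_residual R L N d X _ _ _ _ _ _ _ _ wl bl vl ul.
by move/(cvg_unique (@norm_hausdorff _ _) resl).
Qed.

End Objective.

(** * The penalty updates *)

(** The updates only see the norms of the residuals and of the multipliers: [c]
    and [x] below. *)
Section OuterLoop.
Context {R : realType} (theta eta1 eta2 eta3 eta4 : R) (gamma : nat).
Context (heta1 : 0 < eta1 < 1) (heta2 : 0 < eta2 < 1) (heta4 : 0 < eta4 < 1).
Context (heta3 : 1 < eta3) (hgamma : (0 < gamma)%N) (htheta : 0 <= theta).
Context (c x rho eps : nat -> R).
Context (c_ge0 : forall k, 0 <= c k) (x_ge0 : forall k, 0 <= x k).
Context (rho0_gt0 : 0 < rho 0%N) (eps0_gt0 : 0 < eps 0%N).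
Context (x_step : forall k, x k.+1 <= x k + rho k * c k.+1).
Context (c_step : forall k,
  c k.+1 ^+ 2 <= 4 * theta / rho k + 4 * (x k / rho k) ^+ 2).

(** The decrease test of the iteration [k + 1]. *)
Definition decreased k :=
  c k.+1 <= eta1 * \big[Num.max/0]_(k.+1 - gamma <= t < k.+1) c t.

Context (update : forall k, (rho k.+1, eps k.+1) =
  if (k.+1 <= gamma)%N then (rho k, eps k)
  else if decreased k then (rho k, Num.sqrt eta1 * eps k)
  else (Num.max (rho k / eta2) (x k.+1 `^ (1 + eta3)), eta4 * eps k)).

Definition increase k := (gamma < k.+1)%N && ~~ decreased k.

Let rho_keep k : ~~ increase k -> rho k.+1 = rho k.
Proof.
rewrite /increase negb_and -leqNgt negbK => ki; have := update k.
case: (leqP k.+1 gamma) ki => [_ _ []//|_ /= dk].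
by rewrite dk => -[].
Qed.

Let rho_increase k : increase k ->
  rho k.+1 = Num.max (rho k / eta2) (x k.+1 `^ (1 + eta3)).
Proof.
by case/andP=> gk /negbTE kd; have := update k; rewrite leqNgt gk /= kd => -[].
Qed.

Lemma penalty_gt0 k : 0 < rho k.
Proof.
elim: k => // k IHk; have [ki|ki] := boolP (increase k).
  rewrite rho_increase // lt_max divr_gt0 //; by case/andP: heta2.
by rewrite rho_keep.
Qed.

Let rho_gt0 : forall k, 0 < rho k := penalty_gt0.

Let rho_mono j k : (j <= k)%N -> rho j <= rho k.
Proof.
move=> jk; rewrite -(subnKC jk); elim: (k - j)%N => [|n IHn]; first by rewrite addn0.
apply: (le_trans IHn); rewrite addnS; set i := (j + n)%N.
have [ki|ki] := boolP (increase i); last by rewrite rho_keep.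
rewrite rho_increase // le_max; apply/orP; left; case/andP: heta2 => e0 e1.
by rewrite ler_pdivlMr // ger_pMr // ltW.
Qed.

Lemma tolerance_cvg0 : eps @ \oo --> (0 : R).
Proof.
case/andP: heta1 => e10 e11; case/andP: heta4 => e40 e41.
pose q := Num.max (Num.sqrt eta1) eta4.
have q1 : q < 1.
  rewrite gt_max e41 andbT -[ltRHS]sqrtr1 ltr_sqrt //; exact: ltr01.
have q0 : 0 < q by rewrite lt_max sqrtr_gt0 e10.
have eps_gt0 k : 0 < eps k.
  elim: k => // k IHk; have := update k; case: ifP => _; first by case=> _ ->.
  by case: ifP => _ [_ ->]; rewrite mulr_gt0 // sqrtr_gt0.
have eps_step k : (gamma <= k)%N -> eps k.+1 <= q * eps k.
  move=> gk; have := update k; rewrite leqNgt ltnS gk /=.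
  by case: ifP => _ [_ ->]; rewrite ler_pM2r // le_max lexx ?orbT.
have eps_le n : eps (n + gamma)%N <= eps gamma * q ^+ n.
  elim: n => [|n IHn]; first by rewrite expr0 mulr1.
  rewrite addSn (le_trans (eps_step _ (leq_addl _ _))) // exprS mulrCA.
  by rewrite ler_pM2l.
rewrite -(cvg_shiftn gamma).
apply: (@squeeze_cvgr _ _ _ _ (fun=> 0) (fun n => eps gamma * q ^+ n)).
- by apply: nearW => n; rewrite ltW //= eps_le.
- exact: cvg_cst.
- rewrite -[X in _ --> X](mulr0 (eps gamma)); apply: cvgM; first exact: cvg_cst.
  by apply: cvg_expr; rewrite ger0_norm ?ltW.
Qed.

(** An increase makes the penalty dominate the square of the multiplier, as
    [2 <= 1 + eta3]; the term [(rho 0)^-1] of the constant covers the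
    multipliers of norm at most 1. *)
Let K := 1 + (rho 0%N)^-1.
Let K_gt0 : 0 < K. Proof. by rewrite addr_gt0 // invr_gt0. Qed.

Let increase_bound k : increase k -> x k.+1 ^+ 2 <= K * rho k.+1.
Proof.
move=> ki; rewrite mulrDl mul1r.
have r0 := rho_gt0 k.+1; have [x1|x1] := leP (x k.+1) 1.
  apply: (@le_trans _ _ 1); first by rewrite expr_le1.
  rewrite -[leLHS]add0r lerD ?(ltW r0) // mulrC ler_pdivlMr // mul1r.
  exact: rho_mono.
apply: (@le_trans _ _ (rho k.+1)); last first.
  by rewrite lerDl mulr_ge0 ?(ltW r0) // invr_ge0 ltW.
rewrite rho_increase // le_max; apply/orP; right.
rewrite -powR_mulrn //; apply: ler_powR; first exact: ltW.
by have := heta3; lra.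
Qed.

(** ** Infinitely many increases *)

Section ManyIncreases.
Context (often : forall m, exists2 k, (m <= k)%N & increase k).

(** Each increase multiplies the penalty by at least [eta2^-1]. *)
Let rho_large B : exists2 m, increase m & forall k, (m < k)%N -> B <= rho k.
Proof.
case/andP: heta2 => e0 e1.
have grow n : exists m, rho 0%N <= eta2 ^+ n * rho m.
  elim: n => [|n [m IHn]]; first by exists 0%N; rewrite expr0 mul1r.
  have [k mk ki] := often m; exists k.+1.
  apply: (le_trans IHn); rewrite exprSr -mulrA ler_wpM2l ?exprn_ge0 ?(ltW e0) //.
  rewrite mulrC -ler_pdivrMr // rho_increase // le_max; apply/orP; left.
  by rewrite ler_pM2r ?invr_gt0 // rho_mono.
have [n nB] : exists n, eta2 ^+ n * `|B| <= rho 0%N.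
  have [->|B0] := eqVneq B 0; first by exists 0%N; rewrite normr0 mulr0 ltW.
  have e1' : `|eta2| < 1 by rewrite gtr0_norm.
  have Bp : 0 < rho 0%N / `|B| by rewrite divr_gt0 // normr_gt0.
  have /cvgrPdist_lt /(_ _ Bp) [n _ /(_ n (leqnn n))] := cvg_expr e1'.
  rewrite /= sub0r normrN ger0_norm ?exprn_ge0 ?(ltW e0) // => H.
  by exists n; rewrite -ler_pdivlMr ?normr_gt0 // ltW.
have [m rm] := grow n; have [k mk ki] := often m.
exists k => // j kj; apply: (le_trans (ler_norm B)).
have en : 0 < eta2 ^+ n by rewrite exprn_gt0.
rewrite -(ler_pM2l en); apply: (le_trans nB); apply: (le_trans rm).
by rewrite ler_pM2l // rho_mono // (leq_trans mk) // ltnW.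
Qed.

Let ratio_small r : 0 < r -> exists2 m, increase m &
  forall k, (m <= k)%N ->
    theta / rho k.+1 <= r ^+ 2 /\ (increase k -> x k.+1 / rho k.+1 <= r).
Proof.
move=> r0; have r2 : 0 < r ^+ 2 by rewrite exprn_gt0.
have [m mi mB] := rho_large ((theta + K) / r ^+ 2).
exists m => // k mk; have := mB _ (mk : (m < k.+1)%N).
have rk := rho_gt0 k.+1; rewrite ler_pdivrMr // => H.
have tK : theta <= theta + K by rewrite lerDl ltW.
split; first by rewrite ler_pdivrMr // mulrC (le_trans tK).
move=> /increase_bound xb; rewrite ler_pdivrMr // -ler_sqr ?nnegrE //; last first.
  by rewrite mulr_ge0 // ltW.
apply: (le_trans xb); rewrite exprMn expr2 [rho _ ^+ 2]expr2 mulrA -expr2.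
rewrite ler_pM2r // mulrC; apply: le_trans H; by rewrite lerDr.
Qed.

Let residual_small r k : 0 <= r ->
  theta / rho k <= r ^+ 2 -> x k / rho k <= r -> c k.+1 <= 3 * r.
Proof.
move=> r0 tr xr; rewrite -ler_sqr ?nnegrE ?mulr_ge0 //.
apply: (le_trans (c_step k)).
have : (x k / rho k) ^+ 2 <= r ^+ 2.
  by rewrite ler_sqr ?nnegrE // divr_ge0 // ltW.
by rewrite -mulrA; move: (theta / rho k) ((x k / rho k) ^+ 2) tr => ? ? ? ?; nra.
Qed.

Lemma residual_small_often e m : 0 < e ->
  exists j, [/\ (m <= j)%N, c j.+1 <= e & x j ^+ 2 <= K * rho j].
Proof.
move=> e0; have r0 : 0 < e / 3 by rewrite divr_gt0.
have [m' _ H] := ratio_small r0.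
have [k /[!geq_max]/andP[mk m'k] ki] := often (maxn m m').
exists k.+1; split; [exact: leqW | | exact: increase_bound].
have [tr /(_ ki) xr] := H _ m'k.
rewrite (_ : e = 3 * (e / 3)); first by apply: residual_small => //; exact: ltW.
by field.
Qed.

(** With a window of length one, [x / rho] grows by at most the residual
    between two increases, and the residual decays geometrically there: the
    combination [x / rho + eta1 / (1 - eta1) * c] does not increase, while
    the residual at the next increase is controlled by [x / rho] only. *)
Lemma residual_cvg0_many : gamma = 1%N -> c @ \oo --> (0 : R).
Proof.
move=> gamma1; case/andP: heta1 => e0 e1; have s0 : 0 < 1 - eta1 by lra.
have decr k : ~~ increase k -> (0 < k)%N -> c k.+1 <= eta1 * c k.
  rewrite /increase gamma1 ltnS => + k0; rewrite k0 negbK /decreased gamma1 subn1.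
  move=> /le_trans; apply; rewrite ler_pM2l //.
  by rewrite big_ltn ?ltnSn // big_geq // ge_max lexx c_ge0.
(* once x / rho is at most r at an increase, all later residuals are at most
   3 P, and 4 P <= 16 r / (1 - eta1) = e *)
apply/cvgrPdist_le => e ep; pose r := e * (1 - eta1) / 16.
have r0 : 0 < r by rewrite !mulr_gt0 // invr_gt0.
have [m mi H] := ratio_small r0; case: (H m (leqnn m)) => _ /(_ mi) xm.
pose P := r + 3 * r / (1 - eta1).
have Pe : 4 * (1 - eta1) * P <= e * (1 - eta1).
  rewrite /P (_ : _ * _ = 4 * (1 - eta1) * r + 12 * r); last by field; rewrite gt_eqF.
  have -> : e * (1 - eta1) = 16 * r by rewrite /r; field.
  nra.
have rP : r <= P by rewrite lerDl !mulr_ge0 ?invr_ge0 // ltW.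
have inv n : x (m.+1 + n)%N / rho (m.+1 + n)%N <= r \/
    x (m.+1 + n)%N / rho (m.+1 + n)%N + c (m.+1 + n)%N * (eta1 / (1 - eta1)) <= P.
  elim: n => [|n IHn]; first by left; rewrite addn0.
  rewrite addnS; set k := (m.+1 + n)%N in IHn *.
  have mk : (m <= k)%N by rewrite /k addSn leqW ?leq_addr.
  have [ki|ki] := boolP (increase k); first by left; case: (H k mk) => _; exact.
  right; have rk := rho_gt0 k.
  have xs : x k.+1 / rho k.+1 <= x k / rho k + c k.+1.
    rewrite rho_keep // ler_pdivrMr // mulrDl divfK ?gt_eqF //.
    by rewrite [c _ * _]mulrC.
  have ce : x k.+1 / rho k.+1 + c k.+1 * (eta1 / (1 - eta1))
      <= x k / rho k + c k.+1 / (1 - eta1).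
    have -> : c k.+1 / (1 - eta1) = c k.+1 + c k.+1 * (eta1 / (1 - eta1)).
      by field; rewrite gt_eqF.
    by rewrite addrA lerD2r.
  apply: (le_trans ce); case: IHn => [xr|]; last first.
    apply: le_trans; rewrite lerD2l mulrA ler_pM2r ?invr_gt0 // mulrC.
    by apply: decr => //; rewrite /k addSn.
  apply: lerD => //; rewrite ler_pM2r ?invr_gt0 //.
  apply: residual_small => //; first exact: ltW.
  by rewrite /k addSn; case: (H (m + n)%N (leq_addr _ _)).
exists m.+2 => // k mk; rewrite sub0r normrN ger0_norm //.
have -> : k = (m.+1 + (k - m.+2)).+1 by rewrite -addSn subnKC.
set n := (k - m.+2)%N.
apply: (@le_trans _ _ (3 * P)).
  apply: residual_small.
  - exact: le_trans (ltW r0) rP.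
  - rewrite addSn; case: (H (m + n)%N (leq_addr _ _)) => tr _.
    by apply: (le_trans tr); rewrite ler_sqr ?nnegrE ?(ltW r0) // (le_trans _ rP) ?ltW.
  - case: (inv n) => [/le_trans->//|]; apply: le_trans; rewrite lerDl.
    by rewrite mulr_ge0 // divr_ge0 // ltW.
nra.
Qed.

End ManyIncreases.

(** ** Finitely many increases *)

Lemma bernoulli_exprn (y : R) n : 0 <= y <= 1 -> 1 - n%:R * y <= (1 - y) ^+ n.
Proof.
case/andP=> y0 y1; elim: n => [|n IHn]; first by rewrite mul0r subr0.
have n0 : 0 <= n%:R :> R by exact: ler0n.
rewrite exprS -natr1; have : (1 - y) * (1 - n%:R * y) <= (1 - y) * (1 - y) ^+ n.
  by rewrite ler_wpM2l // subr_ge0.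
apply: le_trans; move: (n%:R : R) n0 => s s0; nra.
Qed.

Section FewIncreases.
Context (k0 : nat) (k0_gamma : (gamma <= k0)%N).
Context (never : forall k, (k0 <= k)%N -> ~~ increase k).

(** The rate [q] is chosen such that [eta1 <= q ^+ gamma], by the Bernoulli
    inequality, so that a decrease by [eta1] with respect to the worst of the last
    [gamma] residuals propagates the bound [C * q ^+ k]. *)
Let geometric_decay : exists C q, [/\ 0 <= C, 0 < q < 1 &
  forall k, c k <= C * q ^+ k].
Proof.
case/andP: heta1 => e0 e1.
have g0 : 0 < gamma%:R :> R by rewrite ltr0n.
pose q := 1 - (1 - eta1) / gamma%:R.
have y1 : 0 < (1 - eta1) / gamma%:R <= 1 - eta1.
  rewrite divr_gt0 ?subr_gt0 //= ler_pdivrMr // ler_peMr ?subr_ge0 ?(ltW e1) //.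
  by rewrite ler1n.
have qe : eta1 <= q ^+ gamma.
  apply: le_trans (bernoulli_exprn gamma (y := (1 - eta1) / gamma%:R) _).
    by rewrite mulrC divfK ?gt_eqF //; lra.
  by case/andP: y1 => y1 y2; rewrite ltW //=; lra.
have q01 : 0 < q < 1 by rewrite /q; case/andP: y1 => ? ?; apply/andP; split; lra.
have [q0 q1] := andP q01.
pose C := \sum_(t < k0.+1) c t / q ^+ t.
have term0 t : 0 <= c t / q ^+ t by rewrite divr_ge0 // exprn_ge0 // ltW.
have C0 : 0 <= C by exact: sumr_ge0.
exists C, q; split=> // k; have [n kn] := ubnP k.
elim: n k kn => // n IHn k kn; have [kk0|] := leqP k k0.
  rewrite -ler_pdivrMr ?exprn_gt0 // /C.
  by rewrite (bigD1 (Ordinal (kk0 : (k < k0.+1)%N))) //= lerDl sumr_ge0.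
case: k kn => // k kn k0k.
have dk : decreased k.
  have := never (k0k : (k0 <= k)%N); rewrite /increase negb_and negbK.
  by rewrite ltnS (leq_trans k0_gamma).
have gk : (gamma <= k.+1)%N by rewrite (leq_trans k0_gamma) // ltnW.
apply: (le_trans dk); apply: (@le_trans _ _ (eta1 * (C * q ^+ (k.+1 - gamma)))).
  rewrite ler_pM2l // big_nat; apply: bigmax_le => [|t /andP[gt tk]].
    by rewrite mulr_ge0 // exprn_ge0 // ltW.
  apply: (le_trans (IHn t _)); first exact: leq_trans tk _.
  rewrite ler_wpM2l // ler_wiXn2l // ltW //.
rewrite mulrCA ler_wpM2l // -{2}(subnK gk) exprD mulrC.
by rewrite ler_wpM2l // exprn_ge0 // ltW.
Qed.

Lemma residual_cvg0_few : c @ \oo --> (0 : R).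
Proof.
have [C [q [C0 /andP[q0 q1] cC]]] := geometric_decay.
apply: (@squeeze_cvgr _ _ _ _ (fun=> 0) (fun n => C * q ^+ n)).
- by apply: nearW => n; rewrite c_ge0 cC.
- exact: cvg_cst.
- rewrite -[X in _ --> X](mulr0 C); apply: cvgM; first exact: cvg_cst.
  by apply: cvg_expr; rewrite ger0_norm ?ltW.
Qed.

(** The penalty stays constant, and the multiplier moves by summable steps. *)
Lemma multiplier_bounded_few :
  exists B, forall k, (k0 <= k)%N -> x k ^+ 2 <= B * rho k.
Proof.
have [C [q [C0 /andP[q0 q1] cC]]] := geometric_decay.
have s0 : 0 < 1 - q by rewrite subr_gt0.
pose T k := rho k0 * C / (1 - q) * q ^+ k.+1.
have T0 k : 0 <= T k.
  by rewrite !mulr_ge0 ?invr_ge0 ?exprn_ge0 // ltW.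
have rhoE n : rho (k0 + n)%N = rho k0.
  by elim: n => [|n IHn]; rewrite ?addn0 // addnS rho_keep // never // leq_addr.
(* the tail of the geometric series pays for all the later increments *)
have xT n : x (k0 + n)%N + T (k0 + n)%N <= x k0 + T k0.
  elim: n => [|n IHn]; first by rewrite addn0.
  apply: le_trans IHn; rewrite addnS; set k := (k0 + n)%N.
  apply: (le_trans (lerD (x_step k) (lexx _))); rewrite -addrA lerD2l rhoE.
  have -> : T k = rho k0 * (C * q ^+ k.+1) + T k.+1.
    by rewrite /T [q ^+ k.+2]exprS; field; rewrite gt_eqF.
  by rewrite lerD2r ler_pM2l.
exists ((x k0 + T k0) ^+ 2 / rho k0) => k kk0.
rewrite -(subnKC kk0) rhoE divfK ?gt_eqF // ler_sqr ?nnegrE ?addr_ge0 //.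
by apply: le_trans (xT (k - k0)%N); rewrite lerDl.
Qed.

End FewIncreases.

(** ** The residual over all iterations *)

Let increase_dichotomy :
  (forall m, exists2 k, (m <= k)%N & increase k) \/
  exists2 k0, (gamma <= k0)%N & forall k, (k0 <= k)%N -> ~~ increase k.
Proof.
have [H|/existsNP[m H]] := pselect (forall m, exists2 k, (m <= k)%N & increase k).
  by left.
right; exists (maxn gamma m) => [|k]; first exact: leq_maxl.
rewrite geq_max => /andP[_ mk]; apply/negP => ki; apply: H; by exists k.
Qed.

(** At such iterations the next residual is small and the next objective value
    is bounded, which is what an accumulation point requires. *)
Lemma good_iterations : exists B, forall e m, 0 < e ->
  exists j, [/\ (m <= j)%N, c j.+1 <= e & x j ^+ 2 <= B * rho j].
Proof.
have [often|[k0 k0g never]] := increase_dichotomy.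
  by exists K => e m; exact: residual_small_often.
have [B xB] := multiplier_bounded_few k0g never.
exists B => e m e0.
have /cvgrPdist_lt /(_ _ e0) [n _ nP] := residual_cvg0_few k0g never.
exists (maxn k0 (maxn m n)); split.
- by rewrite !leq_max leqnn orbT.
- have := nP (maxn k0 (maxn m n)).+1; rewrite /= sub0r normrN ger0_norm // => H.
  by rewrite ltW // H // leqW // !leq_max leqnn !orbT.
- by apply: xB; rewrite leq_maxl.
Qed.

Lemma residual_cvg0 : gamma = 1%N -> c @ \oo --> (0 : R).
Proof.
have [often|[k0 k0g never] _] := increase_dichotomy.
  exact: residual_cvg0_many.
exact: residual_cvg0_few never.
Qed.

End OuterLoop.

Theorem theorem16 (R : realType) (L N : nat) (d : nat -> nat)
  (hN : (0 < N)%N) (hd : forall l, (l <= L.+1)%N -> (0 < d l)%N)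
  (X : 'M[R]_(d 0%N, N)) (Y : 'M[R]_(d L.+1, N))
  (alpha lw lv : R) (beta : 'I_L.+1 -> R)
  (halpha : 0 < alpha < 1) (hlw : 0 < lw) (hlv : 0 < lv)
  (hbeta : forall l, 0 < beta l)
  (theta : R) (htheta : N%:R^-1 * frob2 Y < theta)
  (eta1 eta2 eta3 eta4 : R) (gamma : nat)
  (heta1 : 0 < eta1 < 1) (heta2 : 0 < eta2 < 1) (heta4 : 0 < eta4 < 1)
  (heta3 : 1 < eta3) (hgamma : (0 < gamma)%N)
  (w : nat -> 'cV[R]_(dim_w L d)) (b : nat -> 'cV[R]_(dim_b L d))
  (v u xi : nat -> 'cV[R]_(dim_v L N d)) (rho eps : nat -> R)
  (hinit : Omega_theta X Y alpha lw lv beta theta (w 0%N) (b 0%N) (v 0%N) (u 0%N))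
  (hrho0 : 0 < rho 0%N) (heps0 : 0 < eps 0%N)
  (halg : algorithm1 X Y alpha lw lv beta theta eta1 eta2 eta3 eta4 gamma
            w b v u xi rho eps) :
  let z k := stack d (w k) (b k) (v k) (u k) in
  let c k := enorm (residual X (w k) (b k) (v k) (u k)) in
  let KKT := on_stack d (KKT_point X Y alpha lw lv beta) in
  [/\ limn_einf (fun k => (c k)%:E) = 0%E
        /\ (exists zstar, cluster (z @ \oo) zstar),
      limn_einf (fun k => dist_to (z k) KKT) = 0%E
    & gamma = 1%N ->
        c @ \oo --> 0 /\
        (forall zstar, cluster (z @ \oo) zstar -> KKT zstar)].
Proof.
move=> z c KKT.
have feas := alg_feasible halg.
have theta0 : 0 <= theta.
  apply: le_trans (ltW htheta); rewrite mulr_ge0 ?invr_ge0 //.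
  by apply: sumr_ge0 => i _; apply: sumr_ge0 => j _; exact: sqr_ge0.
have c_ge0 k : 0 <= c k by exact: enorm_ge0.
pose x k := enorm (xi k).
have x_ge0 k : 0 <= x k by exact: enorm_ge0.
have update k : (rho k.+1, eps k.+1) =
    if (k.+1 <= gamma)%N then (rho k, eps k)
    else if decreased eta1 gamma c k then (rho k, Num.sqrt eta1 * eps k)
    else (Num.max (rho k / eta2) (x k.+1 `^ (1 + eta3)), eta4 * eps k).
  exact: alg_update halg k.
have rho_gt0 := penalty_gt0 heta2 hrho0 update.
have bounds k := aug_lag_bounds hlw hlv hbeta theta0 (rho_gt0 k)
  (feas k) (alg_descent halg k).
have x_step k : x k.+1 <= x k + rho k * c k.+1.
  rewrite /x (alg_multiplier halg); apply: (le_trans (ler_enormD _ _)).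
  by rewrite enormZ gtr0_norm.
have c_step k : c k.+1 ^+ 2 <= 4 * theta / rho k + 4 * (x k / rho k) ^+ 2.
  by case: (bounds k).
have eps0 : eps @ \oo --> (0 : R).
  exact: (tolerance_cvg0 heta1 heta4 heps0 update).
have [B good] := good_iterations heta1 heta2 heta3 hgamma theta0 c_ge0 x_ge0
  hrho0 x_step c_step update.
have c_cvg0 := residual_cvg0 heta1 heta2 heta3 hgamma theta0 c_ge0 x_ge0
  hrho0 x_step c_step update.
(* the shift: the point of the iteration k + 1 is almost stationary for the
   Lagrangian with the parameters of index k *)
have limit_KKT (phi : nat -> nat) zs : phi @ \oo --> \oo ->
    (fun k => z (phi k).+1) @ \oo --> zs ->
    residual X (w_part zs) (b_part zs) (v_part zs) (u_part zs) = 0 -> KKT zs.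
  move=> phioo zzs res0.
  apply: (almost_stationary_limit_KKT halpha hbeta
    (rho := rho \o phi) (xi := xi \o phi) (eps := fun k => eps (phi k).+1)
    zzs _ _ res0) => [|k].
    have eps1 : (fun k => eps k.+1) @ \oo --> (0 : R) by rewrite (cvg_shiftS eps).
    exact: cvg_comp phioo eps1.
  exact: alg_stationary halg (phi k).
have [phi [phioo [zs [zzs res0]] c0]] : exists phi : nat -> nat,
    [/\ phi @ \oo --> \oo, exists zs, (fun k => z (phi k).+1) @ \oo --> zs /\
      residual X (w_part zs) (b_part zs) (v_part zs) (u_part zs) = 0
    & (fun k => c (phi k).+1) @ \oo --> (0 : R)].
  have /choice [chi chiP] : forall m, exists j,
      [/\ (m <= j)%N, c j.+1 <= m.+1%:R^-1 & x j ^+ 2 <= B * rho j].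
    by move=> m; apply: good; rewrite invr_gt0.
  have chioo : chi @ \oo --> \oo.
    move=> P [m _ mP]; exists m => // k /= mk; apply: mP => /=.
    by case: (chiP k) => kc _ _; exact: leq_trans kc.
  have cchi : (fun k => c (chi k).+1) @ \oo --> (0 : R).
    apply: (@squeeze_cvgr _ _ _ _ (fun=> 0) (fun k => k.+1%:R^-1)).
    - by apply: nearW => k; rewrite c_ge0 /=; case: (chiP k).
    - exact: cvg_cst.
    - exact: cvg_harmonic.
  have [k|k||psi psioo [ws [bs [vs [us [zl resl]]]]]] :=
    @bounded_obj_subcvg R L N d hN X Y alpha lw lv beta halpha hlw hlv hbeta
      (fun k => w (chi k).+1) (fun k => b (chi k).+1)
      (fun k => v (chi k).+1) (fun k => u (chi k).+1) (theta + B).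
  - exact: feas.
  - case: (bounds (chi k)) => /le_trans + _; apply; rewrite lerD2l.
    by rewrite ler_pdivrMr //; case: (chiP k).
  - by apply/cvg_enormP; under eq_cvg do rewrite subr0.
  exists (chi \o psi); split.
  - exact: cvg_comp psioo chioo.
  - by exists (stack d ws bs vs us); rewrite !part_stack.
  - exact: cvg_comp psioo cchi.
have late (e : R) m : 0 < e -> exists k, [/\ (m <= (phi k).+1)%N,
    c (phi k).+1 < e & enorm (z (phi k).+1 - zs) < e].
  move=> e0; near \oo => k; exists k; split.
  - by apply: leqW; near: k; exact: phioo (nbhs_infty_ge m).
  - rewrite -[ltLHS]ger0_norm // -normrN -[- _]sub0r.
    by near: k; move/cvgrPdist_lt: c0; apply.
  - by near: k; exact: cvg_enorm_lt.
split.
- split.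
    apply: limn_einf_eq0 => [k|e m e0]; first by rewrite lee_fin.
    have [k [mk ck _]] := late e m e0.
    by exists (phi k).+1 => //; rewrite lee_fin ltW.
  exists zs => A U [m _ mA] /near_enormP [e e0 eU].
  have [k [mk _ ze]] := late e m e0.
  by exists (z (phi k).+1); split; [exact: mA|exact: eU].
- have Kzs : KKT zs := limit_KKT _ _ phioo zzs res0.
  apply: limn_einf_eq0 => [k|e m e0]; first exact: dist_to_ge0.
  have [k [mk _ ze]] := late e m e0.
  exists (phi k).+1 => //; apply: le_trans (dist_to_le _ Kzs) _.
  by rewrite lee_fin ltW.
- move=> gamma1; have {}c_cvg0 := c_cvg0 gamma1; split=> // zc zcl.
  have /choice [psi psiP] : forall m, exists k,
      (m <= k)%N /\ enorm (z k.+1 - zc) < m.+1%:R^-1.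
    move=> m; have e0 : 0 < m.+1%:R^-1 :> R by rewrite invr_gt0.
    have [_ [[[|k] /= mk <-] ze]] :
        [set z k | k in [set k | (m < k)%N]] `&`
        [set y | enorm (y - zc) < m.+1%:R^-1] !=set0.
      apply: zcl; last by apply/near_enormP; exists m.+1%:R^-1.
      by exists m.+1 => // k /= mk; exists k.
    - by [].
    - by exists k.
  have psioo : psi @ \oo --> \oo.
    move=> P [m _ mP]; exists m => // k /= mk; apply: mP => /=.
    by case: (psiP k) => kc _; exact: leq_trans kc.
  have zpsi : (fun k => z (psi k).+1) @ \oo --> zc.
    apply: (@cvg_near _ _ (fun=> zc) _ _ (fun k => k.+1%:R^-1)).
    - exact: cvg_cst.
    - exact: cvg_harmonic.
    - by move=> k; rewrite ltW //; case: (psiP k).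
  apply: (limit_KKT psi) => //.
  have [wl bl vl ul] := cvg_parts zpsi.
  have /cvg_enorm rl := @cvg_residual R L N d X _ _ _ _ _ _ _ _ wl bl vl ul.
  apply: dot_eq0; rewrite -sqr_enorm; apply/eqP; rewrite sqrf_eq0; apply/eqP.
  have cpsi : (fun k => c (psi k).+1) @ \oo --> (0 : R).
    have c1 : (fun k => c k.+1) @ \oo --> (0 : R) by rewrite (cvg_shiftS c).
    exact: cvg_comp psioo c1.
  by apply: (limit_eq rl cpsi) => k; rewrite !part_stack.
Unshelve. all: by end_near. Qed.
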